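(* Let $X_n\sim\mathrm{Beta}_p(a_n,a_n)$ where $a_n/n\to\gamma\in(0,\infty)$. Then (i) $X_n\to\tfrac12I_p$ in $L^2$ (i.e. $\mathbb{E}\|X_n-\tfrac12I_p\|^2\to0$ for the Frobenius norm), and (ii) $\sqrt{8\gamma n}\,(X_n-\tfrac12I_p)\xrightarrow{\mathcal{D}}G$ as $n\to\infty$, where $G$ is GOE distributed.
   Context: $\mathcal{S}_p(\mathbb{R})$: real symmetric $p\times p$ matrices with Lebesgue measure $dX=\prod_{i\le j}dx_{i,j}$ and Frobenius norm $\|X\|=\sqrt{\operatorname{tr}X^2}$. $\mathrm{Beta}_p(a,b)$ ($a,b>\tfrac12(p-1)$) has density $B_p(a,b)^{-1}(\det X)^{a-(p+1)/2}\det(I_p-X)^{b-(p+1)/2}\mathbf{1}_{\{0_p<X<I_p\}}$, with $B_p(a,b)=\Gamma_p(a)\Gamma_p(b)/\Gamma_p(a+b)$, $\Gamma_p(a)=\pi^{p(p-1)/4}\prod_{i=1}^p\Gamma(a-\tfrac12(i-1))$. GOE: density $(2\pi)^{-p/2}\pi^{-p(p-1)/4}e^{-\frac12\operatorname{tr}X^2}$ with respect to $dX$. *)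

(* Defs.v *)
From HB Require Import structures.
From mathcomp Require Import all_boot all_order all_algebra.
From mathcomp Require Import all_classical all_reals all_analysis.
Set Implicit Arguments. Unset Strict Implicit. Unset Printing Implicit Defensive.
Import Order.TTheory GRing.Theory Num.Theory.
Import numFieldNormedType.Exports.
Local Open Scope classical_set_scope.
Local Open Scope ring_scope.

Definition coord_S (p : nat) := ('I_p * 'I_p)%type.

Definition upd_S {R : realType} {p : nat} (env : coord_S p -> R) (k : coord_S p) (x : R)
  : coord_S p -> R := fun k' => if k' == k then x else env k'.

(* iterated Lebesgue integral over the coordinates listed in s; the other
   coordinates are read from env *)
Fixpoint iint_S {R : realType} {p : nat} (s : seq (coord_S p))
    (f : (coord_S p -> R) -> \bar R) (env : coord_S p -> R) : \bar R :=
  match s with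
  | [::] => f env
  | k :: s' => (\int[@lebesgue_measure R]_(x in [set: R]) iint_S s' f (upd_S env k x))%E
  end.

Definition ucoords_S (p : nat) : seq (coord_S p) :=
  seq.filter (fun ij : coord_S p => (nat_of_ord ij.1 <= nat_of_ord ij.2)%N) (enum [set: coord_S p]%SET).

Definition symmat_S {R : realType} {p : nat} (v : coord_S p -> R) : 'M[R]_p :=
  \matrix_(i, j) (if (i <= j)%N then v (i, j) else v (j, i)).

(* \int_{S_p(R)} F(X) dX,  with dX = prod_{i<=j} dx_{ij} *)
Definition intS_S {R : realType} (p : nat) (F : 'M[R]_p -> \bar R) : \bar R :=
  iint_S (ucoords_S p) (fun v => F (symmat_S v)) (fun _ => 0).

Definition symmetric_S {R : realType} {p : nat} (X : 'M[R]_p) : Prop := X^T = X.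

Definition posdef_S {R : realType} {p : nat} (X : 'M[R]_p) : Prop :=
  symmetric_S X /\ forall v : 'cV[R]_p, v != 0 -> 0 < (v^T *m X *m v) ord0 ord0.

Definition fnorm_S {R : realType} {p : nat} (X : 'M[R]_p) : R :=
  Num.sqrt (\tr (X *m X)).

Definition Gamma_S {R : realType} (a : R) : R :=
  fine (\int[@lebesgue_measure R]_(x in [set x : R | (0 < x)%R])
          ((x `^ (a - 1)) * expR (- x))%R%:E)%E.

Definition mGamma_S {R : realType} (p : nat) (a : R) : R :=
  pi `^ ((p * (p - 1))%N%:R / 4) *
  \prod_(i < p) Gamma_S (a - i%:R / 2).

Definition mBeta_S {R : realType} (p : nat) (a b : R) : R :=
  mGamma_S p a * mGamma_S p b / mGamma_S p (a + b).

Definition beta_pdf_S {R : realType} (p : nat) (a b : R) (X : 'M[R]_p) : R :=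
  if `[< posdef_S X /\ posdef_S (1%:M - X) >] then
    (\det X) `^ (a - (p.+1)%:R / 2) * (\det (1%:M - X)) `^ (b - (p.+1)%:R / 2)
      / mBeta_S p a b
  else 0.

Definition goe_pdf_S {R : realType} (p : nat) (X : 'M[R]_p) : R :=
  (2 * pi) `^ (- (p%:R / 2)) * pi `^ (- ((p * (p - 1))%N%:R / 4)) *
  expR (- (\tr (X *m X)) / 2).

Arguments intS_S {R} p F.
Arguments beta_pdf_S {R} p a b X.
Arguments goe_pdf_S {R} p X.

(* Main.v *)
(* Put X = I/2 + Y/s with s = sqrt(8 gamma n) and alpha = a_n - (p+1)/2.  Then
   det X det (I - X) = 4^-p det (I - 4 Y^2/s^2), and for a positive definite W
   Hadamard's inequality applied to W and to its inverse gives
     exp (p - tr W^-1) <= det W <= exp (tr W - p).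
   With W = I - 4 Y^2/s^2, the density of Y without its normalizing constant is
   therefore bounded by a Gaussian and converges to exp (- tr Y^2 / 2), while
   the normalizing constant converges by Stirling's formula.  Dominated
   convergence yields both claims; for (i) it is applied to tr (Y^2) / s^2.

   The cut-off densities are continuous, since det X det (I - X) vanishes on
   the boundary of the region 0 < X < I; this makes every partial integral in
   the iterated integrals continuous, hence measurable. *)

Require Import Defs.
From HB Require Import structures.
From mathcomp Require Import all_boot all_order all_algebra.
From mathcomp Require Import all_classical all_reals all_analysis.
From mathcomp Require Import measurable_realfun ring lra.
Set Implicit Arguments. Unset Strict Implicit. Unset Printing Implicit Defensive.
Import Order.TTheory GRing.Theory Num.Theory.
Import numFieldNormedType.Exports.
Local Open Scope classical_set_scope.
Local Open Scope ring_scope.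

(** * Positive definite matrices *)

(** The integral over symmetric matrices is an iterated one-variable integral, so dominated
    convergence and the change of variables are both carried out one coordinate at a time. This
    calls for a dominating function that is a product over coordinates, and for convergence of the
    integrands along convergent sequences of environments, not just pointwise.

    The Gaussian bound is fixed by the limit 1/2 of [4 * al n / s n ^+ 2]: this quantity is
    eventually at least 1/4, which bounds the unnormalized density of Y by exp(- tr Y^2 / 4). Half
    of that exponent absorbs test functions as large as M exp(tr Y^2 / 8); the other half is at most
    a product of one-variable functions exp(- x^2 / 8). Bounded test functions and tr(Y^2) / s^2 are
    therefore covered by the same limit theorem.

    The constant 8 in s comes from the normalization: the Jacobian, the factor 4^(-p alpha) and the
    Gamma quotients combine into (8 a_n / s^2)^(p(p+1)/4), up to a factor that converges to the GOE
    constant. *)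

Section quadratic_forms.
Context {R : realType}.

Lemma symmetric_S_congr n (P D : 'M[R]_n) :
  symmetric_S D -> symmetric_S (P^T *m D *m P).
Proof. by rewrite /symmetric_S => sD; rewrite !trmx_mul trmxK sD mulmxA. Qed.

Lemma posdef_S_congr n (P D : 'M[R]_n) :
  P \in unitmx -> posdef_S D -> posdef_S (P^T *m D *m P).
Proof.
move=> uP [sD pD]; split; first exact: symmetric_S_congr.
move=> v v0; have := pD (P *m v); rewrite trmx_mul !mulmxA; apply.
apply: contra_neq v0 => Pv0.
by rewrite -[v]mul1mx -(mulVmx uP) -mulmxA Pv0 mulmx0.
Qed.

Lemma posdef_S_congrE n (P D : 'M[R]_n) :
  P \in unitmx -> posdef_S (P^T *m D *m P) <-> posdef_S D.
Proof.
move=> uP; split; last exact: posdef_S_congr.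
have uV : invmx P \in unitmx by rewrite unitmx_inv.
move=> /(posdef_S_congr uV); congr posdef_S.
rewrite !mulmxA -trmx_mul mulmxV// trmx1 mul1mx -mulmxA mulmxV//.
by rewrite mulmx1.
Qed.

Lemma qform_block_diag m n (A : 'M[R]_m) (D : 'M[R]_n) (u : 'cV[R]_m)
    (v : 'cV[R]_n) :
  ((col_mx u v)^T *m block_mx A 0 0 D *m col_mx u v) ord0 ord0 =
  (u^T *m A *m u) ord0 ord0 + (v^T *m D *m v) ord0 ord0 :> R.
Proof.
rewrite tr_col_mx mul_row_block !mulmx0 addr0 add0r mul_row_col.
by rewrite mxE.
Qed.

Lemma posdef_S_block_diag m n (A : 'M[R]_m) (D : 'M[R]_n) :
  posdef_S (block_mx A 0 0 D) <-> posdef_S A /\ posdef_S D.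
Proof.
split=> [[s p]|[[sA pA] [sD pD]]].
  move: s; rewrite /symmetric_S tr_block_mx !trmx0.
  move=> /eq_block_mx[sA _ _ sD]; split; split=> // v v0.
    have /p : col_mx v 0 != 0 :> 'cV[R]_(m + n).
      by rewrite col_mx_eq0 negb_and v0.
    by rewrite qform_block_diag mulmx0 [X in _ + X]mxE addr0.
  have /p : col_mx 0 v != 0 :> 'cV[R]_(m + n).
    by rewrite col_mx_eq0 negb_and v0 orbT.
  by rewrite qform_block_diag mulmx0 [X in X + _]mxE add0r.
split; first by rewrite /symmetric_S tr_block_mx !trmx0 sA sD.
move=> w; rewrite -[w]vsubmxK qform_block_diag col_mx_eq0 negb_and.
have qA (u : 'cV_m) : 0 <= (u^T *m A *m u) ord0 ord0.
  by have [->|u0] := eqVneq u 0; [rewrite mulmx0 mxE|exact/ltW/pA].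
have qD (u : 'cV_n) : 0 <= (u^T *m D *m u) ord0 ord0.
  by have [->|u0] := eqVneq u 0; [rewrite mulmx0 mxE|exact/ltW/pD].
by case/orP=> [/pA|/pD] ?; [exact: ltr_pwDl|exact: ltr_wpDl].
Qed.

Lemma posdef_S_scalar1 (a : R) : posdef_S (a%:M : 'M[R]_1) <-> 0 < a.
Proof.
have q (v : 'cV[R]_1) : (v^T *m a%:M *m v) ord0 ord0 = a * v ord0 ord0 ^+ 2.
  rewrite mul_mx_scalar -scalemxAl mxE mxE big_ord1 mxE; congr (_ * _).
split=> [[_ /(_ 1%:M)]|a0].
  by rewrite q mxE eqxx expr1n mulr1; apply; rewrite -[1%:M]/(1%R) oner_neq0.
split; first by rewrite /symmetric_S tr_scalar_mx.
move=> v v0; rewrite q mulr_gt0// exprn_even_gt0//=.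
by apply: contra_neq v0 => v0; apply/matrixP => i j; rewrite !ord1 v0 mxE.
Qed.

(** Eliminating the single entry [X 0 0] lowers the dimension by one, so that the facts below on
    determinants and openness are plain inductions, without spectral theory. *)
Definition schur n (X : 'M[R]_(1 + n)) : 'M[R]_n :=
  drsubmx X - (X 0 0)^-1 *: ((ursubmx X)^T *m ursubmx X).

Definition schur_pivot n (X : 'M[R]_(1 + n)) : 'M[R]_(1 + n) :=
  block_mx 1%:M ((X 0 0)^-1 *: ursubmx X) 0 1%:M.

Lemma det_schur_pivot n (X : 'M[R]_(1 + n)) : \det (schur_pivot X) = 1.
Proof. by rewrite /schur_pivot det_ublock !det1 mulr1. Qed.

Lemma schur_pivot_unit n (X : 'M[R]_(1 + n)) : schur_pivot X \in unitmx.
Proof. by rewrite unitmxE det_schur_pivot unitr1. Qed.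

Lemma schur_decomposition n (X : 'M[R]_(1 + n)) :
  symmetric_S X -> X 0 0 != 0 ->
  X = (schur_pivot X)^T *m block_mx (X 0 0)%:M 0 0 (schur X)
      *m schur_pivot X.
Proof.
move=> sX a0.
have ul : ulsubmx X = (X 0 0)%:M.
  apply/matrixP => i j; rewrite !ord1 !mxE eqxx mulr1n.
  by congr (X _ _); apply/val_inj.
have dl : dlsubmx X = (ursubmx X)^T by rewrite trmx_ursub sX.
rewrite /schur_pivot tr_block_mx !trmx0 !trmx1 !mulmx_block.
have -> : ((X 0 0)^-1 *: ursubmx X)^T = (X 0 0)^-1 *: (ursubmx X)^T.
  exact: linearZ.
rewrite !mul1mx !mul0mx !mulmx0 !addr0 !mulmx1 !add0r.
rewrite -scalemxAl mul_mx_scalar scalerA mulVf// scale1r.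
rewrite mul_scalar_mx scalerA divff// scale1r -scalemxAr /schur.
by rewrite [X in block_mx _ _ _ X]addrC subrK -ul -dl ?add0r ?addr0 submxK.
Qed.

Lemma det_schur n (X : 'M[R]_(1 + n)) : symmetric_S X -> X 0 0 != 0 ->
  \det X = X 0 0 * \det (schur X).
Proof.
move=> sX a0; rewrite [in LHS](schur_decomposition sX a0) !det_mulmx.
rewrite det_tr det_schur_pivot mulr1 mul1r det_ublock det_scalar1.
by [].
Qed.

Lemma posdef_S_diag n (X : 'M[R]_n) i : posdef_S X -> 0 < X i i.
Proof.
move=> [_ /(_ (delta_mx i 0))].
rewrite trmx_delta -rowE -colE !mxE; apply.
by apply/eqP => /matrixP/(_ i 0); rewrite !mxE !eqxx => /eqP; rewrite oner_eq0.
Qed.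

Lemma posdef_S_schur n (X : 'M[R]_(1 + n)) : symmetric_S X ->
  posdef_S X <-> 0 < X 0 0 /\ posdef_S (schur X).
Proof.
move=> sX; split=> [pX|[a0 pS]].
  have a0 := posdef_S_diag 0 pX; split=> //; move: pX.
  rewrite [X in posdef_S X](schur_decomposition sX) ?gt_eqF//.
  rewrite posdef_S_congrE ?schur_pivot_unit//.
  by move=> /posdef_S_block_diag[].
rewrite (schur_decomposition sX) ?gt_eqF//.
apply/posdef_S_congr; first exact: schur_pivot_unit.
by apply/posdef_S_block_diag; split=> //; exact/posdef_S_scalar1.
Qed.

Lemma posdef_S_det_gt0 n (X : 'M[R]_n) : posdef_S X -> 0 < \det X.
Proof.
elim: n X => [X _|n IH X pX]; first by rewrite det_mx00.
have [a0 pS] := (posdef_S_schur pX.1).1 pX.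
by rewrite (@det_schur n) ?gt_eqF//; [rewrite mulr_gt0// IH|exact: pX.1].
Qed.

(* Hadamard's inequality: passing to the Schur complement only decreases the
   diagonal. *)
Lemma posdef_S_det_le_prod n (X : 'M[R]_n) :
  posdef_S X -> \det X <= \prod_i X i i.
Proof.
elim: n X => [X _|n IH X pX]; first by rewrite det_mx00 big_ord0.
have [a0 pS] := (posdef_S_schur pX.1).1 pX.
rewrite (@det_schur n) ?gt_eqF//; last exact: pX.1.
rewrite big_ord_recl ler_pM2l//; apply: (le_trans (IH _ pS)).
apply: ler_prod => i _; rewrite ltW ?posdef_S_diag//=.
rewrite !mxE big_ord1 !mxE.
have -> : @rshift 1 n i = lift ord0 i by apply/val_inj.
by rewrite gerBl mulr_ge0 ?invr_ge0 ?(ltW a0)// -expr2 sqr_ge0.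
Qed.

Lemma posdef_S_unit n (X : 'M[R]_n) : posdef_S X -> X \in unitmx.
Proof. by move=> /posdef_S_det_gt0 d; rewrite unitmxE unitfE gt_eqF. Qed.

Lemma posdef_S_inv n (X : 'M[R]_n) : posdef_S X -> posdef_S (invmx X).
Proof.
move=> pX; have uX := posdef_S_unit pX.
have -> : invmx X = (invmx X)^T *m X *m invmx X.
  by rewrite -mulmxA mulmxV// mulmx1 trmx_inv pX.1.
by apply: posdef_S_congr => //; rewrite unitmx_inv.
Qed.

(** Hadamard's inequality, then [x <= exp (x - 1)] on each diagonal entry. *)
Lemma posdef_S_det_le_exp n (X : 'M[R]_n) :
  posdef_S X -> \det X <= expR (\tr X - n%:R).
Proof.
move=> pX; apply: (le_trans (posdef_S_det_le_prod pX)).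
have -> : \tr X - n%:R = \sum_i (X i i - 1).
  by rewrite big_split/= sumr_const card_ord mulNrn.
rewrite expR_sum; apply: ler_prod => i _; rewrite ltW ?posdef_S_diag//=.
by apply: le_trans (expR_ge1Dx _); rewrite addrC subrK.
Qed.

Lemma posdef_S_det_ge_exp n (X : 'M[R]_n) :
  posdef_S X -> expR (n%:R - \tr (invmx X)) <= \det X.
Proof.
move=> pX; have := posdef_S_det_le_exp (posdef_S_inv pX).
rewrite det_inv -opprB expRN lef_pV2// ?posrE ?expR_gt0//.
exact: posdef_S_det_gt0.
Qed.

(** With Y = 1 - X, the factors commute and add up to 1, so XY = XY(X + Y) = XYX + YXY, and both
    summands are congruences of positive definite matrices. *)
Lemma posdef_S_mul_onem n (X : 'M[R]_n) :
  posdef_S X -> posdef_S (1%:M - X) -> posdef_S (X *m (1%:M - X)).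
Proof.
move=> pX pY; set Y := 1%:M - X in pY *.
have XY : X *m Y = Y *m X by rewrite /Y mulmxBr mulmxBl mulmx1 mul1mx.
have sXY : symmetric_S (X *m Y) by rewrite /symmetric_S trmx_mul pX.1 pY.1.
have -> : X *m Y = X *m Y *m X + Y *m X *m Y.
  by rewrite XY -mulmxDr [X + Y]addrC subrK mulmx1.
have pA : posdef_S (X *m Y *m X).
  by rewrite -{1}pX.1; apply: posdef_S_congr => //; exact: posdef_S_unit.
have pB : posdef_S (Y *m X *m Y).
  by rewrite -{1}pY.1; apply: posdef_S_congr => //; exact: posdef_S_unit.
split; first by rewrite /symmetric_S linearD/= pA.1 pB.1.
move=> v v0; rewrite mulmxDr mulmxDl mxE.
by rewrite addr_gt0// ?pA.2// pB.2.
Qed.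

Lemma posdef_S_scale n (c : R) (X : 'M[R]_n) :
  0 < c -> posdef_S X -> posdef_S (c *: X).
Proof.
move=> c0 [sX pX]; split; first by rewrite /symmetric_S linearZ/= sX.
by move=> v v0; rewrite -scalemxAr -scalemxAl mxE mulr_gt0// pX.
Qed.

(** If the form vanishes at v, moving from v in the direction - Xv would make it negative to first
    order unless Xv = 0, which a nonzero determinant forbids. *)
Lemma psd_det_neq0_posdef n (X : 'M[R]_n) : symmetric_S X ->
  (forall v : 'cV[R]_n, 0 <= (v^T *m X *m v) ord0 ord0) ->
  \det X != 0 -> posdef_S X.
Proof.
move=> sX pX dX; split=> // v v0; rewrite lt_neqAle pX andbT eq_sym.
apply: contra_neq dX => qv.
have sq (y : 'cV[R]_n) : (y^T *m y) ord0 ord0 = \sum_i y i ord0 ^+ 2.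
  by rewrite mxE; apply: eq_bigr => i _; rewrite mxE expr2.
pose w := X *m v; pose m := (w^T *m w) ord0 ord0.
pose q := (w^T *m X *m w) ord0 ord0.
have q0 : 0 <= q by exact: pX.
have m0 : 0 <= m by rewrite /m sq sumr_ge0// => i _; exact: sqr_ge0.
have vw : v^T *m X = w^T by rewrite /w trmx_mul sX.
have expand t : 0 <= t ^+ 2 * q - 2 * (t * m).
  have := pX (v - t *: w).
  have -> : (v - t *: w)^T = v^T - t *: w^T by rewrite linearB/= linearZ.
  rewrite !mulmxBl !mulmxBr -!scalemxAl -!scalemxAr.
  have e1 : w^T *m X *m v = w^T *m w by rewrite -mulmxA.
  have mB (A B : 'M[R]_1) : (A - B) ord0 ord0 = A ord0 ord0 - B ord0 ord0.
    by rewrite !mxE.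
  have mZ c (A : 'M[R]_1) : (c *: A) ord0 ord0 = c * A ord0 ord0.
    by rewrite mxE.
  rewrite vw e1 !(mB, mZ) -/m -/q.
  have -> : (w^T *m v) ord0 ord0 = 0 by rewrite -vw qv.
  by move=> h; lra.
have m00 : m = 0.
  have q1 : 0 < q + 1 by lra.
  (* The minimizer of the quadratic is [m / q]; the denominator [q + 1] covers [q = 0] as well and
     still gives a negative value when [m] is nonzero. *)
  have := expand (m / (q + 1)).
  have -> : (m / (q + 1)) ^+ 2 * q - 2 * (m / (q + 1) * m) =
    - (m ^+ 2 / (q + 1) * (2 - q / (q + 1))) by field; lra.
  rewrite oppr_ge0 pmulr_lle0; last first.
    by rewrite subr_gt0 ltr_pdivrMr//; lra.
  rewrite pmulr_lle0 ?invr_gt0// => m2.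
  by apply/eqP; rewrite -sqrf_eq0 eq_le m2 sqr_ge0.
have w0 : w = 0.
  apply/matrixP => i j; rewrite ord1 [RHS]mxE; apply/eqP.
  rewrite -sqrf_eq0; move: m00; rewrite /m sq => /eqP.
  rewrite psumr_eq0 => [/allP/(_ i (mem_index_enum i))//|? _].
  exact: sqr_ge0.
apply/eqP/det0P; exists v^T.
  by apply: contra_neq v0 => /(congr1 trmx); rewrite trmxK trmx0.
by rewrite vw w0 trmx0.
Qed.

End quadratic_forms.

Lemma cvg_near_eqn (T : topologicalType) (f g : nat -> T) (l : T) :
  (\forall n \near \oo, f n = g n) ->
  f n @[n --> \oo] --> l -> g n @[n --> \oo] --> l.
Proof.
move=> fg; apply: cvg_trans; apply: near_eq_cvg.
by apply: filterS fg => n ->.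
Qed.

(** * Entrywise convergence of matrices *)

Section matrix_sequences.
Context {R : realType}.

Definition mx_cvg m n (A : nat -> 'M[R]_(m, n)) (B : 'M[R]_(m, n)) :=
  forall i j, A k i j @[k --> \oo] --> B i j.

Lemma cvg_sum_fin (I : Type) (r : seq I) (P : pred I) (F : I -> nat -> R)
    (l : I -> R) :
  (forall i, P i -> F i k @[k --> \oo] --> l i) ->
  (\sum_(i <- r | P i) F i k) @[k --> \oo] --> \sum_(i <- r | P i) l i.
Proof.
move=> Fl; elim: r => [|i r IH].
  by rewrite big_nil; under eq_fun do rewrite big_nil; exact: cvg_cst.
rewrite big_cons; under eq_fun do rewrite big_cons.
by case: ifPn => // Pi; apply: cvgD => //; exact: Fl.
Qed.

Lemma cvg_prod_fin (I : Type) (r : seq I) (P : pred I) (F : I -> nat -> R)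
    (l : I -> R) :
  (forall i, P i -> F i k @[k --> \oo] --> l i) ->
  (\prod_(i <- r | P i) F i k) @[k --> \oo] --> \prod_(i <- r | P i) l i.
Proof.
move=> Fl; elim: r => [|i r IH].
  by rewrite big_nil; under eq_fun do rewrite big_nil; exact: cvg_cst.
rewrite big_cons; under eq_fun do rewrite big_cons.
by case: ifPn => // Pi; apply: cvgM => //; exact: Fl.
Qed.

Lemma mx_cvg_cst m n (A : 'M[R]_(m, n)) : mx_cvg (fun=> A) A.
Proof. by move=> i j; exact: cvg_cst. Qed.

Lemma mx_cvgD m n (A A' : nat -> 'M[R]_(m, n)) B B' :
  mx_cvg A B -> mx_cvg A' B' -> mx_cvg (fun k => A k + A' k) (B + B').
Proof.
move=> AB AB' i j; rewrite mxE; under eq_fun do rewrite mxE.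
exact: cvgD.
Qed.

Lemma mx_cvgZ m n (c : nat -> R) (d : R) (A : nat -> 'M[R]_(m, n)) B :
  c k @[k --> \oo] --> d -> mx_cvg A B ->
  mx_cvg (fun k => c k *: A k) (d *: B).
Proof.
move=> cd AB i j; rewrite mxE; under eq_fun do rewrite mxE.
exact: cvgM.
Qed.

Lemma mx_cvgN m n (A : nat -> 'M[R]_(m, n)) B :
  mx_cvg A B -> mx_cvg (fun k => - A k) (- B).
Proof.
move=> AB i j; rewrite mxE; under eq_fun do rewrite mxE.
exact: cvgN.
Qed.

Lemma mx_cvgM m n p (A : nat -> 'M[R]_(m, n)) (A' : nat -> 'M[R]_(n, p)) B B' :
  mx_cvg A B -> mx_cvg A' B' -> mx_cvg (fun k => A k *m A' k) (B *m B').
Proof.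
move=> AB AB' i j; rewrite mxE; under eq_fun do rewrite mxE.
by apply: cvg_sum_fin => k _; exact: cvgM.
Qed.

Lemma cvg_mxtrace n (A : nat -> 'M[R]_n) B :
  mx_cvg A B -> \tr (A k) @[k --> \oo] --> \tr B.
Proof. by move=> AB; apply: cvg_sum_fin => i _; exact: AB. Qed.

Lemma cvg_det n (A : nat -> 'M[R]_n) B :
  mx_cvg A B -> \det (A k) @[k --> \oo] --> \det B.
Proof.
move=> AB; apply: cvg_sum_fin => s _; apply: cvgM; first exact: cvg_cst.
by apply: cvg_prod_fin => i _; exact: AB.
Qed.

(** Cramer's formula makes the entries rational in those of [A k]. It describes [invmx] only on
    invertible matrices, hence the passage to large [k]. *)
Lemma mx_cvg_inv n (A : nat -> 'M[R]_n) B : B \in unitmx ->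
  mx_cvg A B -> mx_cvg (fun k => invmx (A k)) (invmx B).
Proof.
move=> uB AB i j; have dB := cvg_det AB.
have dB0 : \det B != 0 by move: uB; rewrite unitmxE unitfE.
have uA : \forall k \near \oo, A k \in unitmx.
  near=> k; rewrite unitmxE unitfE; near: k.
  exact: (cvgr_neq0 _ dB dB0).
have adj : \adj (A k) i j @[k --> \oo] --> \adj B i j.
  rewrite mxE; under eq_fun do rewrite mxE.
  apply: cvgM; first exact: cvg_cst.
  apply: cvg_det => a b; rewrite !mxE; under eq_fun do rewrite !mxE.
  exact: AB.
have : (\det (A k))^-1 * \adj (A k) i j @[k --> \oo] -->
       (\det B)^-1 * \adj B i j.
  by apply: cvgM => //; exact: cvgV.
move=> H; rewrite /invmx uB [X in _ --> X]mxE; apply: (cvg_near_eqn _ H).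
by near=> k; rewrite ifT ?mxE//; near: k.
Unshelve. all: by end_near. Qed.

Lemma posdef_S_open n (A : nat -> 'M[R]_n) B :
  (forall k, symmetric_S (A k)) -> mx_cvg A B -> posdef_S B ->
  \forall k \near \oo, posdef_S (A k).
Proof.
elim: n A B => [A B sA _ _|n IH A B sA AB pB].
  apply: nearW => k; split=> // v v0; exfalso; move/eqP: v0; apply.
  by apply/matrixP => -[].
have [b0 pS] := (@posdef_S_schur _ n _ pB.1).1 pB.
have a0 : \forall k \near \oo, 0 < A k 0 0 by apply: (cvgr_gt _ (AB 0 0)).
have sS k : symmetric_S (@schur _ n (A k)).
  rewrite /symmetric_S /schur linearB/= linearZ/= trmx_mul trmxK.
  by rewrite trmx_drsub sA.
have SS : mx_cvg (fun k => @schur _ n (A k)) (@schur _ n B).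
  apply: mx_cvgD => [i j|].
    by rewrite !mxE; under eq_fun do rewrite !mxE; exact: AB.
  apply: mx_cvgN; apply: mx_cvgZ.
    by apply: cvgV; [rewrite gt_eqF|exact: AB].
  apply: mx_cvgM => i j; rewrite !mxE; under eq_fun do rewrite !mxE;
    exact: AB.
have pA := IH _ _ sS SS pS.
near=> k; apply/(@posdef_S_schur _ n _ (sA k)); split; near: k => //.
Unshelve. all: by end_near. Qed.

Lemma mx_cvg_qform n (A : nat -> 'M[R]_n) B (v : 'cV[R]_n) : mx_cvg A B ->
  (v^T *m A k *m v) ord0 ord0 @[k --> \oo] --> (v^T *m B *m v) ord0 ord0.
Proof.
move=> AB; have /(_ ord0 ord0) := mx_cvgM (mx_cvgM (@mx_cvg_cst 1 n v^T) AB)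
  (@mx_cvg_cst n 1 v).
exact.
Qed.

End matrix_sequences.

(** Transfers continuity in the subspace topology to entrywise convergent sequences: balls of
    matrices are entrywise, and finitely many eventual conditions hold together eventually. *)
Lemma mx_cvg_within {R : realType} {p : nat} (A : set 'M[R]_p)
    (h : 'M[R]_p -> R) (Y : nat -> 'M[R]_p) B :
  {within A, continuous h} -> (forall n, A (Y n)) -> A B -> mx_cvg Y B ->
  h (Y n) @[n --> \oo] --> h B.
Proof.
move=> /subspace_continuousP/(_ B) ch AY AB YB.
apply: (cvg_trans _ (ch AB)) => P /= hP.
suff YB' : Y n @[n --> \oo] --> B.
  exact: (filterS (fun n (q : A (Y n) -> P (h (Y n))) => q (AY n)) (YB' _ hP)).
apply/cvg_ballP => e e0.
have near_ball : \forall n \near \oo, forall k : 'I_p * 'I_p,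
    ball (B k.1 k.2) e (Y n k.1 k.2).
  apply: filter_forall => k; move/cvg_ballP : (YB k.1 k.2); exact.
by apply: filterS near_ball => n nB; split=> // i j; exact: (nB (i, j)).
Qed.

(** * Iterated integrals *)

Lemma seq_continuous (R : realType) (F : R -> R) :
  (forall x y, x n @[n --> \oo] --> y -> F (x n) @[n --> \oo] --> F y) ->
  continuous F.
Proof.
by move=> FF x; apply/(@cvg_nbhsP R R^o F x (F x)) => u ux; exact: FF.
Qed.

Section iterated_integrals.
Context {R : realType} {p : nat}.
Local Notation mu := (@lebesgue_measure R).
Local Notation env := (coord_S p -> R).
Implicit Types (s t : seq (coord_S p)) (u v w : env) (f : env -> R).

Definition env_cvg (u : nat -> env) v :=
  forall k, u n k @[n --> \oo] --> v k.

(* Sequential continuity for the product topology. *)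
Definition env_continuous f :=
  forall (u : nat -> env) v, env_cvg u v -> f (u n) @[n --> \oo] --> f v.

Lemma env_cvg_cst v : env_cvg (fun=> v) v.
Proof. by move=> k; exact: cvg_cst. Qed.

Lemma env_cvg_upd (u : nat -> env) v k (x : nat -> R) y : env_cvg u v ->
  x n @[n --> \oo] --> y ->
  env_cvg (fun n => upd_S (u n) k (x n)) (upd_S v k y).
Proof. by move=> uv xy l; rewrite /upd_S; case: (l == k). Qed.

Lemma iint_S_eq_env s (f : env -> \bar R) u v :
  (forall k, k \notin s -> u k = v k) -> iint_S s f u = iint_S s f v.
Proof.
elim: s u v => [|k s IH] u v uv /=.
  by congr f; apply/funext => k; exact: uv.
apply: eq_integral => x _; apply: IH => l ls; rewrite /upd_S.
by case: eqP => // /eqP lk; apply: uv; rewrite inE negb_or lk.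
Qed.

Variable g : R -> R.
Hypothesis g0 : forall x, 0 <= g x.
Hypothesis g1 : forall x, g x <= 1.
Hypothesis ig : mu.-integrable setT (EFin \o g).
Let I := fine (\int[mu]_x (g x)%:E)%E.

Let IE : (\int[mu]_x (g x)%:E = I%:E)%E.
Proof. by rewrite fineK//; exact: integrable_fin_num. Qed.

Let I0 : 0 <= I.
Proof. by apply: fine_ge0; apply: integral_ge0 => x _; rewrite lee_fin. Qed.

(** The product form reproduces itself: integrating out one coordinate replaces its factor by the
    constant [I] and leaves a bound of the same shape. *)
Definition dominated C s f := forall v, `|f v| <= C * \prod_(k <- s) g (v k).

Let G t v := \prod_(k <- t) g (v k).

Let G0 t v : 0 <= G t v.
Proof. by apply: prodr_ge0 => k _; exact: g0. Qed.

Let G1 t v : G t v <= 1.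
Proof.
rewrite /G; elim: t => [|k t IH]; first by rewrite big_nil.
by rewrite big_cons mulr_ile1// -/(G _ _).
Qed.

(* [t] lists coordinates that are not integrated.  Convergence is required
   along convergent environments so that constant sequences [f_] give the
   continuity, hence the measurability, of the inner integrals. *)
Let iint_dct_subproof s : forall t C (f_ : nat -> env -> R) f,
  uniq (t ++ s) -> 0 <= C ->
  (forall n, env_continuous (f_ n)) -> env_continuous f ->
  (forall (u : nat -> env) v, env_cvg u v ->
    f_ n (u n) @[n --> \oo] --> f v) ->
  (forall n, dominated C (t ++ s) (f_ n)) -> dominated C (t ++ s) f ->
  (forall v, (`|iint_S s (EFin \o f) v| <= (C * I ^+ size s * G t v)%:E)%E) /\
  (forall (u : nat -> env) v, env_cvg u v ->
    iint_S s (EFin \o f_ n) (u n) @[n --> \oo] --> iint_S s (EFin \o f) v).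
Proof.
elim: s => [|k s IH] t C f_ f ut C0 cf_ cf ff df_ df.
  split=> [v|u v uv] /=.
    by rewrite lee_fin expr0 mulr1; have := df v; rewrite cats0.
  by apply: cvg_EFin; [exact: nearW|exact: ff].
have ut' : uniq (rcons t k ++ s) by rewrite cat_rcons.
have kt : k \notin t.
  by move: ut; rewrite cat_uniq/= negb_or => /and3P[_ /andP[]].
have step h : env_continuous h -> dominated C (t ++ k :: s) h ->
  (forall v, (`|iint_S s (EFin \o h) v| <=
     (C * I ^+ size s * G (rcons t k) v)%:E)%E) /\
  (forall (u : nat -> env) v, env_cvg u v ->
    iint_S s (EFin \o h) (u n) @[n --> \oo] --> iint_S s (EFin \o h) v).
  by move=> ch dh; apply: (IH _ _ (fun=> h)) => //; rewrite ?cat_rcons.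
have df_' n : dominated C (rcons t k ++ s) (f_ n) by rewrite cat_rcons.
have df' : dominated C (rcons t k ++ s) f by rewrite cat_rcons.
have [_ cvs] := IH (rcons t k) C f_ f ut' C0 cf_ cf ff df_' df'.
have Gupd v x : G (rcons t k) (upd_S v k x) = G t v * g x.
  rewrite /G -cats1 big_cat big_seq1 /upd_S eqxx; congr (_ * _).
  apply: eq_big_seq => l lt; case: eqP => // lk.
  by move: kt; rewrite -lk lt.
have fin h v : env_continuous h -> dominated C (t ++ k :: s) h ->
    iint_S s (EFin \o h) v \is a fin_num.
  move=> ch dh; have [b _] := step h ch dh.
  rewrite fin_numElt (_ : -oo = - +oo)%E// -lte_absl.
  by apply: le_lt_trans (b v) _; rewrite ltry.
have meas h v : env_continuous h -> dominated C (t ++ k :: s) h ->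
    measurable_fun setT
      ((fun x => iint_S s (EFin \o h) (upd_S v k x)) : R -> \bar R).
  move=> ch dh; have [_ c] := step h ch dh.
  pose F x := fine (iint_S s (EFin \o h) (upd_S v k x)).
  rewrite (_ : (fun x => _) = EFin \o F); last first.
    by apply/funext => x /=; rewrite fineK//; exact: fin.
  apply/measurable_EFinP; apply: continuous_measurable_fun.
  apply: seq_continuous => x y xy; apply: fine_cvg.
  rewrite fineK ?fin//; apply: c; apply: env_cvg_upd => //.
  exact: env_cvg_cst.
have bnd h v x : env_continuous h -> dominated C (t ++ k :: s) h ->
    (`|iint_S s (EFin \o h) (upd_S v k x)| <=
      (C * I ^+ size s * G t v)%:E * (g x)%:E)%E.
  move=> ch dh; have [b _] := step h ch dh.
  by apply: le_trans (b _) _; rewrite Gupd -EFinM mulrA.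
split=> [v|u v uv] /=.
  apply: (le_trans (le_abse_integral _ _ _)) => //; first exact: meas.
  apply: (@le_trans _ _
    (\int[mu]_x ((C * I ^+ size s * G t v)%:E * (g x)%:E))%E).
    apply: ge0_le_integral => //.
    - by apply: measurableT_comp => //; exact: meas.
    - by apply: emeasurable_funM => //; exact: measurable_int ig.
    - by move=> x _; exact: bnd.
  rewrite ge0_integralZl//.
  - by rewrite IE -EFinM lee_fin exprSr; lra.
  - exact: measurable_int ig.
  - by move=> x _; rewrite lee_fin.
  - by rewrite lee_fin !mulr_ge0// exprn_ge0.
pose F_ n x := iint_S s (EFin \o f_ n) (upd_S (u n) k x).
pose F x := iint_S s (EFin \o f) (upd_S v k x).
(* The bound on [F_ n] contains [G t (u n)], which varies with [n]; since [g <= 1] it is at most 1,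
   and what remains is a dominating function independent of [n]. *)
pose H x := ((C * I ^+ size s)%:E * (g x)%:E)%E.
have mF_ n : measurable_fun setT (F_ n) by exact: meas.
have mF : measurable_fun setT F by exact: meas.
have FF : {ae mu, forall x, setT x -> F_ n x @[n --> \oo] --> F x}.
  apply: aeW => x _; apply: cvs; apply: env_cvg_upd => //; exact: cvg_cst.
have iH : mu.-integrable setT H by exact: integrableZl.
have FH : {ae mu, forall x n, setT x -> (`|F_ n x| <= H x)%E}.
  apply: aeW => x n _; apply: (le_trans (bnd _ _ _ _ _)) => //.
  rewrite -!EFinM lee_fin ler_wpM2r// ler_piMr// mulr_ge0//.
  exact: exprn_ge0.
by have [] := @dominated_convergence _ (measurableTypeR R) R mu setT
  measurableT F_ F H mF_ mF FF iH FH.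
Qed.

Section dominated_function.
Variables (s : seq (coord_S p)) (us : uniq s) (C : R) (C0 : 0 <= C).

Theorem iint_S_dct (f_ : nat -> env -> R) f :
  (forall n, env_continuous (f_ n)) -> env_continuous f ->
  (forall (u : nat -> env) v, env_cvg u v ->
    f_ n (u n) @[n --> \oo] --> f v) ->
  (forall n, dominated C s (f_ n)) -> dominated C s f ->
  forall (u : nat -> env) v, env_cvg u v ->
    iint_S s (EFin \o f_ n) (u n) @[n --> \oo] --> iint_S s (EFin \o f) v.
Proof.
move=> cf_ cf ff df_ df.
by have [] := @iint_dct_subproof s [::] C f_ f us C0 cf_ cf ff df_ df.
Qed.

End dominated_function.

Lemma iint_S_fin t s C f v : uniq (t ++ s) -> 0 <= C -> env_continuous f ->
  dominated C (t ++ s) f -> iint_S s (EFin \o f) v \is a fin_num.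
Proof.
move=> us C0 cf df.
have [b _] := @iint_dct_subproof s t C (fun=> f) f us C0 (fun=> cf) cf cf
  (fun=> df) df.
rewrite fin_numElt (_ : -oo = - +oo)%E// -lte_absl.
by apply: le_lt_trans (b v) _; rewrite ltry.
Qed.

(** Presents a partial integral as a real function of one coordinate, continuous and integrable, so
    that one-variable substitution and linearity apply to the next integral. *)
Lemma iint_S_section t k s C f v : uniq (t ++ k :: s) -> 0 <= C ->
  env_continuous f -> dominated C (t ++ k :: s) f ->
  exists F : R -> R, [/\ continuous F,
    mu.-integrable setT (EFin \o F) &
    forall x, iint_S s (EFin \o f) (upd_S v k x) = (F x)%:E].
Proof.
move=> us C0 cf df.
have us' : uniq (rcons t k ++ s) by rewrite cat_rcons.
have df' : dominated C (rcons t k ++ s) f by rewrite cat_rcons.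
have [b c] := @iint_dct_subproof s (rcons t k) C (fun=> f) f us' C0
  (fun=> cf) cf cf (fun=> df') df'.
pose F x := fine (iint_S s (EFin \o f) (upd_S v k x)).
have FE x : iint_S s (EFin \o f) (upd_S v k x) = (F x)%:E.
  by rewrite /F fineK//; exact: iint_S_fin us' C0 cf df'.
have cF : continuous F.
  apply: seq_continuous => x y xy; apply: fine_cvg; rewrite -FE.
  by apply: c; apply: env_cvg_upd => //; exact: env_cvg_cst.
exists F; split=> //.
have := integrableZl measurableT (C * I ^+ size s) ig.
apply: le_integrable => //.
  by apply/measurable_EFinP; exact: continuous_measurable_fun.
move=> x _ /=; have := b (upd_S v k x); rewrite FE !lee_fin => /le_trans.
apply; apply: le_trans (ler_norm _).
rewrite ler_wpM2l//; first by rewrite mulr_ge0// exprn_ge0.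
rewrite /G -cats1 big_cat big_seq1 {2}/upd_S eqxx.
by rewrite ler_piMl// G1.
Qed.

End iterated_integrals.

(** * Affine changes of variables in iterated integrals *)

Section affine_substitution.
Context {R : realType}.
Local Notation mu := (@lebesgue_measure R).

Let ge0_integral_affine (G : R -> R) (a b : R) : 0 < a -> continuous G ->
  (forall x, 0 <= G x) ->
  (\int[mu]_x (G x)%:E = \int[mu]_x (G (a * x + b) * a)%:E)%E.
Proof.
move=> a0 cG G0; pose F x : R := a * x + b.
have dF (x : R) : is_derive x (1 : R) F a.
  by rewrite /F; apply: is_derive_eq; rewrite ?scaler0 ?addr0 ?add0r [LHS]mulr1.
have F' : derive1 F = cst a.
  by apply/funext => x; rewrite derive1E derive_val.
rewrite (@increasing_ge0_integration_by_substitutionT _ F G)//.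
- by apply: eq_integral => x _ /=; rewrite F'.
- by move=> x y xy; rewrite ltrD2r ltr_pM2l.
- by rewrite F'; exact: cst_continuous.
- by rewrite F'; exact: is_cvg_cst.
- by rewrite F'; exact: is_cvg_cst.
- apply/cvgrNyPle => A; exists ((A - b) / a); split; first exact: num_real.
  by move=> x /= /ltW; rewrite ler_pdivlMr// lerBrDr mulrC.
- apply/cvgryPge => A; exists ((A - b) / a); split; first exact: num_real.
  by move=> x /= /ltW; rewrite ler_pdivrMr// lerBlDr mulrC.
Qed.

(** Reduction to the nonnegative case: both parts [max(G, 0)] and [max(- G, 0)] are continuous, and
    multiplication by [a > 0] commutes with these maxima. *)
Lemma integral_affine (G : R -> R) (a b : R) : 0 < a -> continuous G ->
  (\int[mu]_x (G x)%:E = \int[mu]_x (G (a * x + b) * a)%:E)%E.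
Proof.
move=> a0 cG; rewrite integralE [RHS]integralE.
have cmax (h : R -> R) : continuous h -> continuous (fun x => Num.max (h x) 0).
  move=> ch x; under eq_fun do rewrite maxr_absE subr0 addr0.
  apply: cvgM; last exact: cvg_cst.
  by apply: cvgD; [exact: ch|apply: cvg_norm; exact: ch].
have c1 := cmax _ cG.
have c2 : continuous (fun x => Num.max (- G x) 0).
  by apply: cmax => x; apply: cvgN; exact: cG.
have m0 y : 0 <= Num.max y 0 :> R by rewrite le_max lexx orbT.
congr (_ - _)%E.
- transitivity (\int[mu]_x (Num.max (G x) 0)%:E)%E.
    by apply: eq_integral => x _; rewrite funeposE -EFin_max.
  rewrite (ge0_integral_affine b a0 c1)//.
  apply: eq_integral => x _; rewrite funeposE -EFin_max.
  by rewrite maxr_pMl ?ltW// mul0r.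
- transitivity (\int[mu]_x (Num.max (- G x) 0)%:E)%E.
    by apply: eq_integral => x _; rewrite funenegE -EFinN -EFin_max.
  rewrite (ge0_integral_affine b a0 c2)//.
  apply: eq_integral => x _; rewrite funenegE -EFinN -EFin_max.
  by rewrite maxr_pMl ?ltW// mul0r mulNr.
Qed.

Definition env_affine p (a : R) (b : coord_S p -> R) (v : coord_S p -> R) :=
  fun k => a * v k + b k.

Lemma iint_S_affine p (g : R -> R) (a : R) (b : coord_S p -> R) C t s
    (f : (coord_S p -> R) -> R) v :
  (forall x, 0 <= g x) -> (forall x, g x <= 1) ->
  mu.-integrable setT (EFin \o g) ->
  0 < a -> uniq (t ++ s) -> 0 <= C ->
  env_continuous f -> dominated g C (t ++ s) f ->
  iint_S s (EFin \o (f \o env_affine a b)) v =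
  ((a^-1 ^+ size s)%:E * iint_S s (EFin \o f) (env_affine a b v))%E.
Proof.
move=> g0 g1 ig a0 us C0 cf; elim: s t v us => [|k s IH] t v us df /=.
  by rewrite mul1e.
have updE x : env_affine a b (upd_S v k x) =
    upd_S (env_affine a b v) k (a * x + b k).
  by apply/funext => l; rewrite /env_affine /upd_S; case: eqP => [->|].
have us' : uniq (rcons t k ++ s) by rewrite cat_rcons.
have df' : dominated g C (rcons t k ++ s) f by rewrite cat_rcons.
have [F [cF iF FE]] := iint_S_section g0 g1 ig (env_affine a b v) us C0 cf df.
under eq_integral do rewrite (IH (rcons t k))// updE FE -EFinM.
under [in RHS]eq_integral do rewrite FE.
(* One power of [a^-1] more than the inner integrals supply is put in front of [F]; the Jacobian [a]
   of this coordinate cancels it on the other side. *)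
have cF' : continuous (fun x => a^-1 ^+ (size s).+1 * F x).
  by move=> x; apply: cvgM; [exact: cvg_cst|exact: cF].
rewrite -integralZl//.
transitivity (\int[mu]_x (a^-1 ^+ (size s).+1 * F x)%:E)%E; last first.
  by apply: eq_integral => x _; rewrite EFinM.
rewrite (integral_affine (b k) a0 cF'); apply: eq_integral => x _.
by congr EFin; rewrite exprS; field; rewrite gt_eqF.
Qed.

Lemma iint_S_scale p (g : R -> R) C t s (c : R) (f : (coord_S p -> R) -> R) v :
  (forall x, 0 <= g x) -> (forall x, g x <= 1) ->
  mu.-integrable setT (EFin \o g) -> uniq (t ++ s) -> 0 <= C ->
  env_continuous f -> dominated g C (t ++ s) f ->
  iint_S s (EFin \o (fun w => c * f w)) v =
  (c%:E * iint_S s (EFin \o f) v)%E.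
Proof.
move=> g0 g1 ig us C0 cf; elim: s t v us => [|k s IH] t v us df //=.
have us' : uniq (rcons t k ++ s) by rewrite cat_rcons.
have df' : dominated g C (rcons t k ++ s) f by rewrite cat_rcons.
have [F [cF iF FE]] := iint_S_section g0 g1 ig v us C0 cf df.
under eq_integral do rewrite (IH (rcons t k))// FE.
under [in RHS]eq_integral do rewrite FE.
by rewrite -integralZl.
Qed.

End affine_substitution.

(** * Stirling's formula *)

Section powers.
Context {R : realType}.

Lemma powR_expR_ln (x y : R) : 0 < x -> x `^ y = expR (y * ln x).
Proof. by move=> x0; rewrite /powR gt_eqF. Qed.

(** The limit 0 needs its own argument, because the formula through [ln] breaks down there. It is
    the case that makes the density continuous at the boundary of its support. *)
Lemma cvg_powR_ge0 (u : nat -> R) (l a : R) : 0 < a -> (forall n, 0 <= u n) ->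
  u n @[n --> \oo] --> l -> (u n) `^ a @[n --> \oo] --> l `^ a.
Proof.
move=> a0 u0 ul.
have l0 : 0 <= l by apply: (cvgr_to_ge ul); exact: nearW.
have [l00|lN0] := eqVneq l 0; last first.
  have lp : 0 < l by rewrite lt_neqAle eq_sym lN0.
  have : expR (a * ln (u n)) @[n --> \oo] --> expR (a * ln l).
    apply: (cvg_comp _ expR); last exact: continuous_expR.
    apply: cvgM; first exact: cvg_cst.
    by apply: (cvg_comp _ (@ln R) ul); exact: continuous_ln.
  rewrite -powR_expR_ln//; apply: cvg_near_eqn.
  near=> n; rewrite powR_expR_ln//; near: n.
  exact: (cvgr_gt _ ul).
rewrite l00 powR0 ?gt_eqF//; apply/cvgrPdist_lt => e e0.
have d0 : 0 < e `^ a^-1 by exact: powR_gt0.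
near=> n; rewrite sub0r normrN ger0_norm ?powR_ge0//.
have -> : e = (e `^ a^-1) `^ a.
  by rewrite -powRrM mulVf ?gt_eqF// powRr1// ltW.
apply: gt0_ltr_powR => //; rewrite ?inE ?nnegrE ?u0 ?(ltW d0)//.
near: n; apply: (cvgr_lt l) => //; by rewrite l00.
Unshelve. all: by end_near. Qed.

(** The left side vanishes at 0 and has derivative [y ^+ 2 / (1 + y)], at most [2 * v ^+ 2] in
    absolute value between 0 and [v]; the mean value theorem supplies the third factor. *)
Lemma ln1D_taylor2 (v : R) : `|v| <= 2^-1 ->
  `|ln (1 + v) - v + v ^+ 2 / 2| <= 2 * `|v| ^+ 3.
Proof.
move=> v2; pose f (y : R) := ln (1 + y) - y + y ^+ 2 / 2.
pose df (y : R) := y ^+ 2 / (1 + y).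
have dfE (y : R) : - 2^-1 <= y -> is_derive y (1 : R) f (df y).
  move=> y2; have y1 : 0 < 1 + y by lra.
  have dln : is_derive y (1 : R) (fun z => ln (1 + z)) (1 + y)^-1.
    have := is_derive1_ln y1.
    have -> : (fun z => ln (1 + z)) = @ln R \o (cst 1 + id) by [].
    move=> h; apply: is_derive_eq; by rewrite add0r mulr1.
  rewrite /f /df; apply: is_derive_eq.
  by rewrite /GRing.scale/=; field; rewrite gt_eqF.
have f0 : f 0 = 0 by rewrite /f addr0 ln1 expr0n/= mul0r subr0 addr0.
have bnd (c : R) : `|c| <= `|v| -> - 2^-1 <= c -> `|df c * v| <= 2 * `|v| ^+ 3.
  move=> cv c2; have c1 : 0 < 1 + c by lra.
  rewrite normrM exprSr mulrA ler_wpM2r// /df normrM normfV.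
  rewrite (gtr0_norm c1) ler_pdivrMr// normrX.
  have : `|c| ^+ 2 <= `|v| ^+ 2 by rewrite ler_sqr ?nnegrE.
  have := sqr_ge0 `|v|; nra.
have vlo : - 2^-1 <= v by move: v2; rewrite ler_norml => /andP[].
have [v0|v0|v0] := ltgtP v 0.
- have dv (z : R) : z \in `]v, 0[ -> is_derive z (1 : R) f (df z).
    by rewrite in_itv/= => /andP[vz _]; apply: dfE; lra.
  have cv : {within `[v, 0], continuous f}.
    apply: derivable_within_continuous => z; rewrite in_itv/= => /andP[vz _].
    have vz' : - 2^-1 <= z by lra.
    by have [] := dfE _ vz'.
  have [c] := MVT v0 dv cv; rewrite in_itv/= f0 !sub0r => /andP[vc c0].
  rewrite -[f v]/(ln (1 + v) - v + v ^+ 2 / 2) mulrN => /oppr_inj ->.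
  apply: bnd; first by rewrite !ltr0_norm// lerN2 ltW.
  by lra.
- have dv (z : R) : z \in `]0, v[ -> is_derive z (1 : R) f (df z).
    by rewrite in_itv/= => /andP[vz _]; apply: dfE; lra.
  have cv : {within `[0, v], continuous f}.
    apply: derivable_within_continuous => z; rewrite in_itv/= => /andP[vz _].
    have vz' : - 2^-1 <= z by lra.
    by have [] := dfE _ vz'.
  have [c] := MVT v0 dv cv; rewrite in_itv/= f0 !subr0 => /andP[vc c0].
  rewrite -[f v]/(ln (1 + v) - v + v ^+ 2 / 2) => ->.
  by apply: bnd; [rewrite !gtr0_norm// ltW|lra].
- by rewrite v0 -[X in `|X|]/(f 0) f0 normr0 expr0n/= mulr0.
Qed.

End powers.

Section gaussian_integrals.
Context {R : realType}.
Local Notation mu := (@lebesgue_measure R).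
Implicit Types s : R.

Lemma normal_fun_pdf s : s != 0 ->
  EFin \o normal_fun 0 s =
  (fun x => (normal_peak s)^-1%:E * (normal_pdf 0 s x)%:E)%E.
Proof.
move=> s0; apply/funext => x /=; rewrite normal_pdfE// -EFinM mulrA.
by rewrite mulVf ?mul1r// gt_eqF// normal_peak_gt0.
Qed.

Lemma integrable_normal_fun0 s : s != 0 ->
  mu.-integrable setT (EFin \o normal_fun 0 s).
Proof.
move=> s0; rewrite normal_fun_pdf//; apply: integrableZl => //.
exact: integrable_normal_pdf.
Qed.

Lemma integral_normal_fun0 s : s != 0 ->
  (\int[mu]_x (normal_fun 0 s x)%:E = (normal_peak s)^-1%:E)%E.
Proof.
move=> s0; rewrite -[LHS]/(\int[mu]_x (EFin \o normal_fun 0 s) x)%E.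
rewrite normal_fun_pdf// integralZl//; last exact: integrable_normal_pdf.
by rewrite integral_normal_pdf mule1.
Qed.

End gaussian_integrals.

Section stirling.
Context {R : realType}.
Local Notation mu := (@lebesgue_measure R).

(** The maximum extends the Gamma integrand by zero to the whole line; for [x > 0] the extension is
    continuous, as the affine substitution requires. *)
Let gammaf (x t : R) : R := (Num.max t 0) `^ x * expR (- t).

Let gammaf_cont x : 0 < x -> continuous (gammaf x).
Proof.
move=> x0; apply: seq_continuous => u l ul.
apply: cvgM; last first.
  by apply: (cvg_comp _ expR); [exact: cvgN ul|exact: continuous_expR].
apply: cvg_powR_ge0 => // [n|]; first by rewrite le_max lexx orbT.
rewrite maxr_absE subr0 addr0; under eq_fun do rewrite maxr_absE subr0 addr0.
by apply: cvgM; [apply: cvgD => //; exact: cvg_norm|exact: cvg_cst].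
Qed.

Let Gamma_gammaf x : 0 < x ->
  Gamma_S (x + 1) = fine (\int[mu]_t (gammaf x t)%:E)%E.
Proof.
move=> x0; rewrite /Gamma_S addrK; congr fine.
rewrite integral_mkcond; apply: eq_integral => t _.
rewrite patchE; case: ifPn => [|]; rewrite ?inE ?notin_setE/=.
  by move=> t0; rewrite /gammaf max_l// ltW.
move=> /negP; rewrite -leNgt => t0.
by rewrite /gammaf max_r// powR0 ?gt_eqF// mul0r.
Qed.

(* The integrand of [Gamma (x + 1)] recentred at its maximum [x] and rescaled
   by [sqrt x]. *)
Let laplacef (x u : R) : R :=
  gammaf x (Num.sqrt x * u + x) / (x `^ x * expR (- x)).

Let laplacefE x u : 0 < x -> - 1 < u / Num.sqrt x ->
  laplacef x u = expR (x * ln (1 + u / Num.sqrt x) - Num.sqrt x * u).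
Proof.
move=> x0 u1; have s0 : 0 < Num.sqrt x by rewrite sqrtr_gt0.
have sx : Num.sqrt x * Num.sqrt x = x by rewrite -expr2 sqr_sqrtr// ltW.
have v0 : 0 < 1 + u / Num.sqrt x by lra.
have e : Num.sqrt x * u + x = x * (1 + u / Num.sqrt x).
  by rewrite -{2 3}sx; field; rewrite gt_eqF.
rewrite /laplacef /gammaf max_l; last by rewrite e ltW// mulr_gt0.
rewrite {1}e powRM ?ltW// (@powR_expR_ln _ (1 + _))// opprD !expRD expRN.
have xx : x `^ x != 0 by rewrite gt_eqF// powR_gt0.
by field; rewrite xx gt_eqF// expR_gt0.
Qed.

Let laplacef_eq0 x u : 0 < x -> u / Num.sqrt x <= - 1 -> laplacef x u = 0.
Proof.
move=> x0 u1; have s0 : 0 < Num.sqrt x by rewrite sqrtr_gt0.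
have sx : Num.sqrt x * Num.sqrt x = x by rewrite -expr2 sqr_sqrtr// ltW.
have e : Num.sqrt x * u + x = x * (1 + u / Num.sqrt x).
  by rewrite -{2 3}sx; field; rewrite gt_eqF.
rewrite /laplacef /gammaf max_r ?powR0 ?gt_eqF ?mul0r//.
by rewrite e pmulr_rle0//; lra.
Qed.

(** The left tail is bounded by exp(- u^2 / 8). The right tail is only exponential: the second
    summand equals exp(1 - u / 2) for [u >= 0]. *)
Let dom (u : R) : R := normal_fun 0 2 u + 2 * expR 1 * exponential_pdf 2^-1 u.

Let laplacef_le_dom x u : 1 <= x -> `|laplacef x u| <= dom u.
Proof.
move=> x1; have x0 : 0 < x by lra.
have s0 : 0 < Num.sqrt x by rewrite sqrtr_gt0.
have sx : Num.sqrt x * Num.sqrt x = x by rewrite -expr2 sqr_sqrtr// ltW.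
have n0 : 0 <= normal_fun 0 2 u :> R by exact: normal_fun_ge0.
have e0 : 0 <= 2 * expR 1 * exponential_pdf 2^-1 u.
  by rewrite mulr_ge0// ?mulr_ge0 ?expR_ge0// exponential_pdf_ge0.
have [u1|u1] := leP (u / Num.sqrt x) (- 1).
  by rewrite laplacef_eq0// normr0 addr_ge0.
rewrite laplacefE// ger0_norm ?expR_ge0//.
set v := u / Num.sqrt x in u1 *.
have uE : u = Num.sqrt x * v by rewrite /v mulrC divfK// gt_eqF.
pose r := Num.sqrt (1 + v).
have v0 : 0 < 1 + v by lra.
have r0 : 0 < r by rewrite sqrtr_gt0.
have rr : r * r = 1 + v by rewrite -expr2 sqr_sqrtr// ltW.
(* [ln (1 + v) = 2 ln r <= 2 (r - 1)] bounds the exponent by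
   [- x (r - 1) ^ 2], where [x (r - 1) ^ 2 = u ^ 2 / (r + 1) ^ 2]. *)
have lnr : ln (1 + v) <= 2 * (r - 1).
  have lr : ln r <= r - 1.
    have := @le_ln1Dx _ (r - 1); rewrite (_ : 1 + (r - 1) = r); last by ring.
    by apply; lra.
  by rewrite -rr -expr2 lnXn// mulr2n; lra.
have vE : v = r * r - 1 by lra.
have key : x * ln (1 + v) - Num.sqrt x * u <= - (x * (r - 1) ^+ 2).
  rewrite uE mulrA sx.
  have -> : - (x * (r - 1) ^+ 2) = x * (2 * (r - 1)) - x * v.
    by rewrite vE; ring.
  by rewrite lerD2r ler_wpM2l// ltW.
have ru : x * (r - 1) ^+ 2 * (r + 1) ^+ 2 = u ^+ 2.
  have -> : u ^+ 2 = x * v ^+ 2 by rewrite uE exprMn sqr_sqrtr// ltW.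
  by rewrite vE; ring.
have xr0 : 0 <= x * (r - 1) ^+ 2 by rewrite mulr_ge0 ?sqr_ge0 ?ltW.
(* For [u >= 0], [(r + 1) ^+ 2 <= 2 * (u + 2)], so the exponent is at most - u^2 / (2(u + 2)) <= 1 -
   u / 2. For [u < 0], [r <= 1] gives [(r + 1) ^+ 2 <= 4], so it is at most - u^2 / 4. *)
have [u0|u0] := leP 0 u.
  apply: ler_wpDl => //; rewrite exponential_pdfE//.
  have -> : 2 * expR 1 * (2^-1 * expR (- 2^-1 * u)) = expR (1 - 2^-1 * u) :> R.
    by rewrite expRD mulNr; lra.
  rewrite ler_expR; apply: (le_trans key).
  have r2 : (r + 1) ^+ 2 <= 2 * (u + 2).
    have vu : v <= u.
      rewrite /v ler_pdivrMr//; apply: ler_peMr => //.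
      by rewrite -sqrtr1 ler_wsqrtr.
    have := sqr_ge0 (r - 1); nra.
  have : u ^+ 2 <= x * (r - 1) ^+ 2 * (2 * (u + 2)).
    by rewrite -ru ler_wpM2l.
  nra.
apply: ler_wpDr => //; rewrite /normal_fun subr0 ler_expR.
apply: (le_trans key); rewrite mulNr lerN2.
have v00 : v <= 0 by rewrite /v pmulr_lle0 ?invr_gt0// ltW.
have r2 : (r + 1) ^+ 2 <= 4 by nra.
have : u ^+ 2 <= x * (r - 1) ^+ 2 * 4 by rewrite -ru ler_wpM2l.
rewrite -mulr_natr; lra.
Qed.

Let measurable_laplacef x : 0 < x -> measurable_fun setT (laplacef x).
Proof.
move=> x0; apply: continuous_measurable_fun => u.
apply: cvgM; last exact: cvg_cst.
apply: (cvg_comp (fun u => Num.sqrt x * u + x) (gammaf x)).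
  by apply: cvgD; [apply: cvgM; [exact: cvg_cst|exact: cvg_id]|exact: cvg_cst].
exact: gammaf_cont.
Qed.

Let integrable_dom : mu.-integrable setT (EFin \o dom).
Proof.
have -> : EFin \o dom = (fun u => (normal_fun 0 2 u)%:E +
    (2 * expR 1)%:E * (exponential_pdf 2^-1 u)%:E)%E.
  by apply/funext => u /=; rewrite EFinD EFinM.
apply: integrableD => //; first exact: integrable_normal_fun0.
by apply: integrableZl => //; apply: integrable_exponential_pdf; lra.
Qed.

Let integrable_laplacef x : 1 <= x -> mu.-integrable setT (EFin \o laplacef x).
Proof.
move=> x1; apply: le_integrable integrable_dom => //.
  by apply/measurable_EFinP; apply: measurable_laplacef; lra.
move=> u _ /=; rewrite lee_fin; apply: (le_trans (laplacef_le_dom u x1)).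
exact: ler_norm.
Qed.

Let Gamma_laplacef x : 1 <= x -> Gamma_S (x + 1) =
  Num.sqrt x * x `^ x * expR (- x) * fine (\int[mu]_u (laplacef x u)%:E)%E.
Proof.
move=> x1; have x0 : 0 < x by lra.
have s0 : 0 < Num.sqrt x by rewrite sqrtr_gt0.
rewrite Gamma_gammaf// (integral_affine x s0 (gammaf_cont x0)).
set K := _ * expR _.
have -> : (\int[mu]_u (gammaf x (Num.sqrt x * u + x) * Num.sqrt x)%:E)%E =
    (\int[mu]_u (K%:E * (laplacef x u)%:E))%E.
  apply: eq_integral => u _; rewrite -EFinM; congr EFin.
  rewrite /K /laplacef; field.
  by rewrite !gt_eqF ?powR_gt0 ?expR_gt0.
rewrite integralZl//; last exact: integrable_laplacef.
rewrite fineM//; apply: integrable_fin_num => //; exact: integrable_laplacef.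
Qed.

Lemma cvg_sqrtV0 (x : nat -> R) : x n @[n --> \oo] --> +oo ->
  (Num.sqrt (x n))^-1 @[n --> \oo] --> (0 : R).
Proof.
move=> xy; apply/gtr0_cvgV0.
  near=> n; rewrite sqrtr_gt0; near: n.
  by move/cvgryPgt : xy; apply.
apply/cvgryPge => A; near=> n.
apply: (le_trans (ler_norm A)); rewrite -sqrtr_sqr ler_wsqrtr//.
by near: n; move/cvgryPge : xy; apply.
Unshelve. all: by end_near. Qed.

Let laplacef_cvg (x : nat -> R) u : (forall n, 1 <= x n) ->
  x n @[n --> \oo] --> +oo ->
  laplacef (x n) u @[n --> \oo] --> expR (- u ^+ 2 / 2).
Proof.
move=> x1 xy; have x0 n : 0 < x n by exact: lt_le_trans (x1 n).
have s0 n : 0 < Num.sqrt (x n) by rewrite sqrtr_gt0.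
have ss n : x n = Num.sqrt (x n) * Num.sqrt (x n).
  by rewrite -expr2 sqr_sqrtr// ltW.
pose v n := u / Num.sqrt (x n).
have v0 : v n @[n --> \oo] --> (0 : R).
  rewrite -[X in _ --> X](mulr0 u); apply: cvgM; first exact: cvg_cst.
  exact: cvg_sqrtV0.
have v2 : \forall n \near \oo, `|v n| <= 2^-1.
  apply: (cvgr_norm_le _ v0); by rewrite normr0; lra.
(* With [v n = u / sqrt (x n)] the exponent of [laplacef] is exactly [T n - u ^+ 2 / 2], and the
   cubic Taylor bound makes [T n] of order [(sqrt (x n))^-1]. *)
pose T n := x n * (ln (1 + v n) - v n + v n ^+ 2 / 2).
have T0 : T n @[n --> \oo] --> (0 : R).
  apply/norm_cvg0P.
  apply: (@squeeze_cvgr _ _ _ _ (cst 0)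
    (fun n => 2 * `|u| ^+ 3 * (Num.sqrt (x n))^-1)).
  - near=> n; rewrite normr_ge0/=.
    rewrite /T normrM (gtr0_norm (x0 n)).
    apply: (@le_trans _ _ (x n * (2 * `|v n| ^+ 3))).
      rewrite ler_wpM2l ?(ltW (x0 n))//; apply: ln1D_taylor2.
      by near: n.
    rewrite {1}ss /v normrM normfV (gtr0_norm (s0 n)).
    rewrite le_eqVlt; apply/orP; left; apply/eqP; field.
    by rewrite gt_eqF.
  - exact: cvg_cst.
  - rewrite -[X in _ --> X](mulr0 (2 * `|u| ^+ 3)).
    by apply: cvgM; [exact: cvg_cst|exact: cvg_sqrtV0].
have : expR (T n - u ^+ 2 / 2) @[n --> \oo] --> expR (- u ^+ 2 / 2).
  have TT : T n - u ^+ 2 / 2 @[n --> \oo] --> - u ^+ 2 / 2.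
    rewrite -[X in _ --> X]add0r mulNr.
    by apply: cvgB => //; exact: cvg_cst.
  by apply: (cvg_comp _ _ TT); exact: continuous_expR.
apply: cvg_near_eqn; near=> n.
rewrite laplacefE//; last first.
  have : `|v n| <= 2^-1 by near: n.
  by rewrite ler_norml => /andP[]; rewrite /v; lra.
congr expR; rewrite /T -/(v n).
have uE : u = Num.sqrt (x n) * v n by rewrite /v mulrC divfK// gt_eqF.
have e1 : Num.sqrt (x n) * u = x n * v n by rewrite [in LHS]uE mulrA -ss.
have e2 : u ^+ 2 = x n * v n ^+ 2.
  by rewrite [in LHS]uE exprMn sqr_sqrtr// ltW.
by rewrite e1 e2; lra.
Unshelve. all: by end_near. Qed.

Let stirling_ge1 (x : nat -> R) : (forall n, 1 <= x n) ->
  x n @[n --> \oo] --> +oo ->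
  Gamma_S (x n + 1) / (Num.sqrt (x n) * x n `^ x n * expR (- x n))
    @[n --> \oo] --> Num.sqrt (2 * pi).
Proof.
move=> x1 xy; have x0 n : 0 < x n by exact: lt_le_trans (x1 n).
have -> : (fun n => Gamma_S (x n + 1) /
      (Num.sqrt (x n) * x n `^ x n * expR (- x n))) =
    fun n => fine (\int[mu]_u (laplacef (x n) u)%:E)%E.
  apply/funext => n; rewrite Gamma_laplacef// mulrAC divff ?mul1r//.
  by rewrite !mulf_neq0// gt_eqF ?sqrtr_gt0 ?powR_gt0 ?expR_gt0.
apply: fine_cvg.
have -> : (Num.sqrt (2 * pi))%:E = (\int[mu]_u (expR (- u ^+ 2 / 2))%:E)%E.
  have := @integral_normal_fun0 R 1; rewrite oner_neq0 => /(_ isT).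
  rewrite /normal_peak invrK expr1n mul1r mulr_natl => <-.
  by apply: eq_integral => u _; rewrite /normal_fun subr0 expr1n.
pose F_ n (u : R) := (laplacef (x n) u)%:E.
pose F (u : R) := (expR (- u ^+ 2 / 2))%:E.
have mF_ n : measurable_fun setT (F_ n).
  by apply/measurable_EFinP; exact: measurable_laplacef.
have FF : {ae mu, forall u, setT u -> F_ n u @[n --> \oo] --> F u}.
  apply: aeW => u _; apply: cvg_EFin; first exact: nearW.
  exact: laplacef_cvg.
have mF : measurable_fun setT F.
  apply/measurable_EFinP; apply: measurableT_comp => //.
  by apply: measurable_funM => //; apply: measurableT_comp.
have FH : {ae mu, forall u n, setT u -> (`|F_ n u| <= (EFin \o dom) u)%E}.
  by apply: aeW => u n _; rewrite lee_fin; exact: laplacef_le_dom.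
by have [] := @dominated_convergence _ (measurableTypeR R) R mu setT
  measurableT F_ F _ mF_ mF FF integrable_dom FH.
Qed.

(** The domination requires arguments at least 1; replacing [x n] by its maximum with 1 changes only
    finitely many terms. *)
Lemma stirling (x : nat -> R) : x n @[n --> \oo] --> +oo ->
  Gamma_S (x n + 1) / (Num.sqrt (x n) * x n `^ x n * expR (- x n))
    @[n --> \oo] --> Num.sqrt (2 * pi).
Proof.
move=> xy; pose y n := Num.max (x n) 1.
have yy : y n @[n --> \oo] --> +oo.
  apply/cvgryPge => A; near=> n; rewrite le_max; apply/orP; left.
  by near: n; move/cvgryPge : xy; apply.
have y1 n : 1 <= y n by rewrite /y le_max lexx orbT.
have := stirling_ge1 y1 yy.
apply: cvg_near_eqn; near=> n.
have -> // : y n = x n; rewrite /y max_l//.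
by near: n; move/cvgryPge : xy; apply.
Unshelve. all: by end_near. Qed.

(** The comparison function has [ln (a n)] in place of [ln (a n + c)], so that Gamma factors with
    different shifts [c] can be combined by adding exponents. *)
Lemma Gamma_S_asymptotics (a : nat -> R) (c : R) : a n @[n --> \oo] --> +oo ->
  Gamma_S (a n + c) / expR ((a n + c - 2^-1) * ln (a n) - a n)
    @[n --> \oo] --> Num.sqrt (2 * pi).
Proof.
move=> ay; pose d := c - 1; pose e := d + 2^-1; pose x n := a n + d.
have xy : x n @[n --> \oo] --> +oo.
  apply/cvgryPge => A; near=> n; rewrite -lerBlDr; near: n.
  by move/cvgryPge : ay; apply.
have ainv : (a n)^-1 @[n --> \oo] --> (0 : R).
  apply/gtr0_cvgV0 => //; near=> n; near: n.
  by move/cvgryPgt : ay; apply.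
pose y n := d * (a n)^-1.
have y0 : y n @[n --> \oo] --> (0 : R).
  by rewrite -[X in _ --> X](mulr0 d); apply: cvgM => //; exact: cvg_cst.
have y2 : \forall n \near \oo, `|y n| <= 2^-1.
  by apply: (cvgr_norm_le _ y0); rewrite normr0; lra.
pose T n := ln (1 + y n) - y n + y n ^+ 2 / 2.
have T0 : (a n + e) * T n @[n --> \oo] --> (0 : R).
  apply/norm_cvg0P; apply: (@squeeze_cvgr _ _ _ _ (cst 0)
    (fun n => 2 * `|d| * `|y n| ^+ 2 + 2 * `|e| * `|y n| ^+ 3)).
  - near=> n; rewrite normr_ge0/= normrM.
    have a0 : 0 < a n by near: n; move/cvgryPgt : ay; apply.
    have ad : a n * `|y n| = `|d|.
      rewrite /y normrM normfV (gtr0_norm a0); field; by rewrite gt_eqF.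
    apply: (@le_trans _ _ ((a n + `|e|) * (2 * `|y n| ^+ 3))).
      apply: ler_pM => //.
        by rewrite (le_trans (ler_normD _ _))// gtr0_norm.
      by apply: ln1D_taylor2; near: n.
    by rewrite -ad exprS; lra.
  - exact: cvg_cst.
  - have yn : `|y n| @[n --> \oo] --> (0 : R) by apply/norm_cvg0P.
    have yX k : `|y n| ^+ k.+1 @[n --> \oo] --> (0 : R).
      elim: k => [|k IH]; first by under eq_fun do rewrite expr1.
      have -> : (0 : R) = 0 * 0 by rewrite mulr0.
      apply: (cvg_near_eqn _ (cvgM yn IH)).
      by apply: nearW => n; rewrite [RHS]exprS.
    have -> : (0 : R) = 2 * `|d| * 0 + 2 * `|e| * 0 by ring.
    by apply: cvgD; (apply: cvgM; [exact: cvg_cst|exact: yX]).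
(* This is the logarithm of Stirling's denominator at [x n = a n + d] divided by the comparison
   function, with [ln (1 + y n)] expanded to second order and [a n * y n] replaced by [d]. *)
pose D n := (a n + e) * T n + (e * y n - d / 2 * y n - e / 2 * (y n * y n)).
have D0 : expR (D n) @[n --> \oo] --> (1 : R).
  have DD : D n @[n --> \oo] --> (0 : R).
    have -> : (0 : R) = 0 + (e * 0 - d / 2 * 0 - e / 2 * (0 * 0)) by ring.
    apply: cvgD => //; apply: cvgB; [apply: cvgB|];
      (apply: cvgM; [exact: cvg_cst|]) => //.
    exact: cvgM.
  by rewrite -expR0; apply: (cvg_comp _ _ DD); exact: continuous_expR.
rewrite -[X in _ --> X]mulr1.
apply: (cvg_near_eqn _ (cvgM (stirling xy) D0)); near=> n.
have a0 : 0 < a n by near: n; move/cvgryPgt : ay; apply.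
have x0 : 0 < x n by near: n; move/cvgryPgt : xy; apply.
have xc : x n + 1 = a n + c by rewrite /x /d; ring.
have xa : x n = a n * (1 + y n) by rewrite /x /y; field; rewrite gt_eqF.
have y1 : 0 < 1 + y n by move: x0; rewrite xa pmulr_rgt0.
have lnx : ln (x n) = ln (a n) + ln (1 + y n) by rewrite xa lnM.
have yE : a n * y n = d by rewrite /y; field; rewrite gt_eqF.
have -> : Num.sqrt (x n) * x n `^ x n * expR (- x n) =
    expR ((a n + c - 2^-1) * ln (a n) - a n + D n).
  rewrite -powR12_sqrt ?ltW// !powR_expR_ln// -!expRD; congr expR.
  have -> : c = d + 1 by rewrite /d; ring.
  by rewrite lnx /D /T /e -[x n]/(a n + d) -yE; field.
rewrite xc expRD invfM mulrA divfK// gt_eqF// expR_gt0.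
Unshelve. all: by end_near. Qed.

(** The three powers of pi reduce to one, and each index [i] contributes Gamma(a - i/2)^2 / Gamma(2a
    - i/2), which is asymptotic to [sqrt (2 * pi) * expR (- E i n)]. The coefficients (i + 1)/2 sum
    to p(p + 1)/4. *)
Lemma mBeta_S_asymptotics p (a : nat -> R) : a n @[n --> \oo] --> +oo ->
  mBeta_S p (a n) (a n) *
    expR ((p * p.+1)%:R / 4 * (ln (a n) - ln 2) + 2 * a n * p%:R * ln 2)
    @[n --> \oo] -->
  pi `^ ((p * (p - 1))%N%:R / 4) * Num.sqrt (2 * pi) ^+ p.
Proof.
move=> ay; set P := pi `^ _.
have P0 : P != 0 by rewrite gt_eqF// powR_gt0// pi_gt0.
have s0 : Num.sqrt (2 * pi) != 0 :> R.
  by rewrite gt_eqF// sqrtr_gt0 mulr_gt0// pi_gt0.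
have ay2 : a n + a n @[n --> \oo] --> +oo.
  apply/cvgryPge => A; near=> n.
  have : 0 < a n by near: n; move/cvgryPgt : ay; apply.
  have : A <= a n by near: n; move/cvgryPge : ay; apply.
  lra.
pose E (i : 'I_p) n := (i%:R + 1) / 2 * ln (a n) +
  (2 * a n - (i%:R + 1) / 2) * ln 2.
pose r (i : 'I_p) n := Gamma_S (a n - i%:R / 2) ^+ 2 /
  Gamma_S (a n + a n - i%:R / 2) * expR (E i n).
have EE n : (p * p.+1)%:R / 4 * (ln (a n) - ln 2) + 2 * a n * p%:R * ln 2 =
    \sum_i E i n.
  rewrite /E.
  have -> : (p * p.+1)%:R = \sum_(i < p) (2 * (i%:R + 1)) :> R.
    elim: p {E r P P0} => [|q IH]; first by rewrite mul0n big_ord0.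
    by rewrite big_ord_recr/= -IH !natrM -!natr1; ring.
  have -> : p%:R = \sum_(i < p) 1 :> R by rewrite sumr_const card_ord.
  rewrite !mulr_suml mulr_sumr mulr_suml -big_split/=.
  by apply: eq_bigr => i _; lra.
have rl i : r i n @[n --> \oo] --> Num.sqrt (2 * pi).
  have -> : Num.sqrt (2 * pi) =
      Num.sqrt (2 * pi) * Num.sqrt (2 * pi) / Num.sqrt (2 * pi) :> R.
    by rewrite mulfK.
  have h1 := @Gamma_S_asymptotics a (- (i%:R / 2)) ay.
  have h2 := @Gamma_S_asymptotics _ (- (i%:R / 2)) ay2.
  apply: (cvg_near_eqn _ (cvgM (cvgM h1 h1) (cvgV s0 h2))); near=> n.
  have a0 : 0 < a n by near: n; move/cvgryPgt : ay; apply.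
  rewrite /r /=; set A1 := (X in expR X); set A2 := (X in (_ / expR X)^-1).
  have -> : expR (E i n) = expR A2 / (expR A1 * expR A1).
    rewrite -expRD -expRB; congr expR; rewrite /E /A1 /A2.
    have -> : a n + a n = 2 * a n by ring.
    by rewrite lnM ?posrE//; field.
  by rewrite invf_div invfM expr2; ring.
rewrite -[X in _ ^+ X]card_ord -prodr_const.
have -> : (fun n => mBeta_S p (a n) (a n) *
    expR ((p * p.+1)%:R / 4 * (ln (a n) - ln 2) + 2 * a n * p%:R * ln 2)) =
  fun n => P * \prod_i r i n.
  apply/funext => n; rewrite EE expR_sum /mBeta_S /mGamma_S -/P /r.
  rewrite !big_split/= prodfV invfM.
  by move: (\prod_i _)^-1 => B; field.
by apply: cvgM; [exact: cvg_cst|apply: cvg_prod_fin => i _; exact: rl].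
Unshelve. all: by end_near. Qed.

End stirling.

(** * The density on its support *)

Section cut_determinant.
Context {R : realType} {p : nat}.
Implicit Types X Y Z : 'M[R]_p.
Local Notation half := ((2^-1 : R)%:M : 'M[R]_p).

Definition beta_region X := posdef_S X /\ posdef_S (1%:M - X).

(** The factor 4 makes the value at half the identity equal to 1. Keeping the cut-off inside the
    function lets continuity be proved before any power is taken. *)
Definition cutdet X : R :=
  if `[< beta_region X >] then \det (4 *: (X *m (1%:M - X))) else 0.

Lemma half_addM Z :
  4 *: ((half + Z) *m (1%:M - (half + Z))) = 1%:M - 4 *: (Z *m Z).
Proof.
have -> : 1%:M - (half + Z) = half - Z.
  by rewrite opprD addrA -raddfB/=; congr (_%:M - _); field.
rewrite mulmxBr !mulmxDl mul_scalar_mx scale_scalar_mx mul_scalar_mx.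
rewrite mul_mx_scalar opprD addrA addrK scalerBr scale_scalar_mx.
by congr (_%:M - _); field.
Qed.

Lemma beta_region_posdef X :
  beta_region X -> posdef_S (4 *: (X *m (1%:M - X))).
Proof.
by move=> [pX pY]; apply: posdef_S_scale => //; exact: posdef_S_mul_onem.
Qed.

Lemma cutdet_ge0 X : 0 <= cutdet X.
Proof.
rewrite /cutdet; case: asboolP => // rX.
exact/ltW/posdef_S_det_gt0/beta_region_posdef.
Qed.

Lemma cutdet_le Z : cutdet (half + Z) <= expR (- (4 * \tr (Z *m Z))).
Proof.
rewrite /cutdet; case: asboolP => [rX|_]; last exact: expR_ge0.
apply: (le_trans (posdef_S_det_le_exp (beta_region_posdef rX))).
rewrite half_addM linearB/= linearZ/= mxtrace1 ler_expR.
by rewrite addrAC subrr sub0r.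
Qed.

Lemma beta_region_open (X : nat -> 'M[R]_p) B :
  (forall n, symmetric_S (X n)) -> mx_cvg X B -> beta_region B ->
  \forall n \near \oo, beta_region (X n).
Proof.
move=> sX XB [pB pB'].
have h1 := posdef_S_open sX XB pB.
have sX' n : symmetric_S (1%:M - X n).
  by rewrite /symmetric_S linearB/= trmx1 sX.
have XB' : mx_cvg (fun n => 1%:M - X n) (1%:M - B).
  by apply: mx_cvgD; [exact: mx_cvg_cst|exact: mx_cvgN].
have h2 := posdef_S_open sX' XB' pB'.
by near=> n; split; near: n.
Unshelve. all: by end_near. Qed.

Lemma not_posdef_S_near (X : nat -> 'M[R]_p) B : mx_cvg X B -> symmetric_S B ->
  \det B != 0 -> ~ posdef_S B -> \forall n \near \oo, ~ posdef_S (X n).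
Proof.
(* As [B] is nonsingular, its quadratic form takes a negative value. *)
move=> XB sB dB nB.
have [v qv] : exists v : 'cV[R]_p, (v^T *m B *m v) ord0 ord0 < 0.
  apply: contrapT => h; apply: nB; apply: psd_det_neq0_posdef => // v.
  by rewrite leNgt; apply/negP => qv; apply: h; exists v.
have v0 : v != 0 by apply: contraTneq qv => ->; rewrite mulmx0 mxE ltxx.
have q := @mx_cvg_qform _ _ X B v XB.
apply: filterS (@cvgr_lt _ _ _ _ _ _ q _ qv) => n qn.
by move=> [_ /(_ v v0)] /(lt_trans qn); rewrite ltxx.
Qed.

(** Three cases at the limit [B]: inside the region, openness applies; where the determinant
    vanishes, the values are squeezed to 0; otherwise [B] or [1 - B] is nonsingular and not positive
    definite, and so are nearby matrices outside the region. *)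
Lemma cvg_cutdet (X : nat -> 'M[R]_p) B :
  (forall n, symmetric_S (X n)) -> symmetric_S B -> mx_cvg X B ->
  cutdet (X n) @[n --> \oo] --> cutdet B.
Proof.
move=> sX sB XB.
have XB' : mx_cvg (fun n => 1%:M - X n) (1%:M - B).
  by apply: mx_cvgD; [exact: mx_cvg_cst|exact: mx_cvgN].
have dXB : \det (4 *: (X n *m (1%:M - X n))) @[n --> \oo] -->
    \det (4 *: (B *m (1%:M - B))).
  by apply: cvg_det; apply: mx_cvgZ; [exact: cvg_cst|exact: mx_cvgM].
rewrite [X in _ --> X]/cutdet; case: asboolP => [rB|nB].
  apply: (cvg_near_eqn _ dXB).
  apply: filterS (beta_region_open sX XB rB) => n rX.
  by rewrite /cutdet; case: asboolP.
have [d0|dN0] := eqVneq (\det (4 *: (B *m (1%:M - B)))) 0.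
  rewrite d0 in dXB; apply/norm_cvg0P.
  apply: (@squeeze_cvgr _ _ _ _ (cst 0)
    (fun n => `|\det (4 *: (X n *m (1%:M - X n)))|)).
  - apply: nearW => n; rewrite normr_ge0/= /cutdet; case: asboolP => //.
    by rewrite normr0.
  - exact: cvg_cst.
  - exact/norm_cvg0P.
suff : \forall n \near \oo, 0 = cutdet (X n).
  by move=> h; apply: (cvg_near_eqn h); exact: cvg_cst.
have [dB dB'] : \det B != 0 /\ \det (1%:M - B) != 0.
  move: dN0; rewrite detZ det_mulmx mulf_eq0 negb_or => /andP[_].
  by rewrite mulf_eq0 negb_or => /andP.
have sB' : symmetric_S (1%:M - B) by rewrite /symmetric_S linearB/= trmx1 sB.
have {nB} [nB|nB] : ~ posdef_S B \/ ~ posdef_S (1%:M - B) by exact/not_andP.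
  apply: filterS (not_posdef_S_near XB sB dB nB) => n nX.
  by rewrite /cutdet; case: asboolP => // -[].
apply: filterS (not_posdef_S_near XB' sB' dB' nB) => n nX.
by rewrite /cutdet; case: asboolP => // -[].
Qed.

Lemma beta_pdf_cutdet (a : R) X : 0 < a - p.+1%:R / 2 ->
  beta_pdf_S p a a X = cutdet X `^ (a - p.+1%:R / 2) *
    (expR (- (2 * p%:R * (a - p.+1%:R / 2) * ln 2)) / mBeta_S p a a).
Proof.
set al := a - _ => al0; rewrite /beta_pdf_S /cutdet -/al -/(beta_region X).
case: asboolP => [[pX pY]|_]; last by rewrite powR0 ?mul0r// gt_eqF.
have dX := posdef_S_det_gt0 pX; have dY := posdef_S_det_gt0 pY.
rewrite detZ det_mulmx powRM ?exprn_ge0 ?mulr_ge0 ?ltW//.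
rewrite powRM ?ltW// (@powR_expR_ln _ (4 ^+ p)) ?exprn_gt0//.
have -> : al * ln (4 ^+ p) = 2 * p%:R * al * ln 2 :> R.
  rewrite lnXn// (_ : 4 = 2 * 2 :> R); last by ring.
  by rewrite lnM ?posrE// -mulr_natl; ring.
rewrite expRN; set E := expR _; have E0 : E != 0 by rewrite gt_eqF ?expR_gt0.
move: (_ `^ al) (_ `^ al) (_)^-1 => A B C.
by field.
Qed.

End cut_determinant.

(** * The scaling limit *)

Section scaling_limit.
Context {R : realType} {p : nat}.
Local Notation half := ((2^-1 : R)%:M : 'M[R]_p).
Local Notation env := (coord_S p -> R).
Local Notation mu := (@lebesgue_measure R).

Lemma beta_region_half : beta_region half.
Proof.
have p1 : posdef_S (1%:M : 'M[R]_p).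
  split=> [|v v0]; first by rewrite /symmetric_S trmx1.
  rewrite mulmx1 mxE lt_neqAle sumr_ge0 ?andbT; last first.
    by move=> i _; rewrite mxE -expr2 sqr_ge0.
  apply: contra_neq v0 => v0; apply/matrixP => i j; rewrite ord1 mxE.
  apply/eqP; rewrite -sqrf_eq0; move/esym/eqP: v0; rewrite psumr_eq0.
    by move=> /allP/(_ i (mem_index_enum i)); rewrite mxE -expr2.
  by move=> k _; rewrite mxE -expr2 sqr_ge0.
have ph : posdef_S half.
  by rewrite -[X in X%:M]mulr1 -scale_scalar_mx; apply: posdef_S_scale.
split=> //; have -> // : 1%:M - half = half.
by rewrite -raddfB/=; congr (_%:M); field.
Qed.

Lemma symmetric_S_half_add (Y : 'M[R]_p) c :
  symmetric_S Y -> symmetric_S (half + c *: Y).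
Proof. by rewrite /symmetric_S linearD/= linearZ/= tr_scalar_mx => ->. Qed.

(** The constant 1/4 is half of the limit of [4 * al / s ^+ 2], which leaves a single bound valid
    for all large indices. *)
Lemma cutdet_powR_le (Y : 'M[R]_p) (al s : R) : 0 < al -> 0 < s ->
  4^-1 <= 4 * al / s ^+ 2 -> 0 <= \tr (Y *m Y) ->
  cutdet (half + s^-1 *: Y) `^ al <= expR (- (\tr (Y *m Y) / 4)).
Proof.
move=> al0 s0 h t0.
have := @cutdet_le _ _ (s^-1 *: Y).
rewrite -scalemxAl -scalemxAr !mxtraceZ => hle.
apply: (@le_trans _ _ (expR (- (4 * (s^-1 * (s^-1 * \tr (Y *m Y))))) `^ al)).
  exact: (ge0_ler_powR (ltW al0) (cutdet_ge0 _) (expR_ge0 _) hle).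
rewrite -expRM ler_expR mulNr lerN2.
have -> : 4 * (s^-1 * (s^-1 * \tr (Y *m Y))) * al =
    4 * al / s ^+ 2 * \tr (Y *m Y) by field; rewrite gt_eqF.
by rewrite [X in X <= _]mulrC ler_wpM2r.
Qed.

Lemma cvg_cutdet_powR (Y : nat -> 'M[R]_p) B (al s : nat -> R) :
  (forall n, symmetric_S (Y n)) -> mx_cvg Y B ->
  (forall n, 0 < al n) -> (forall n, 0 < s n) ->
  (s n)^-1 @[n --> \oo] --> (0 : R) ->
  4 * al n / s n ^+ 2 @[n --> \oo] --> (2^-1 : R) ->
  cutdet (half + (s n)^-1 *: Y n) `^ al n @[n --> \oo] -->
    expR (- (\tr (B *m B)) / 2).
Proof.
move=> sY YB al0 s0 s'0 als.
pose X n := half + (s n)^-1 *: Y n.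
have sX n : symmetric_S (X n) by exact: symmetric_S_half_add.
have Xh : mx_cvg X half.
  rewrite -[half]addr0; apply: mx_cvgD; first exact: mx_cvg_cst.
  by rewrite -(scale0r B); apply: mx_cvgZ.
have rX := beta_region_open sX Xh beta_region_half.
pose W n := 1%:M - 4 *: ((s n)^-1 *: Y n *m ((s n)^-1 *: Y n)).
have WE n : W n = 4 *: (X n *m (1%:M - X n)) by rewrite half_addM.
have W1 : mx_cvg W 1%:M.
  have -> : 1%:M = 1%:M - 4 *: (0 *: B *m (0 *: B)) :> 'M[R]_p.
    by rewrite scale0r mulmx0 scaler0 subr0.
  apply: mx_cvgD; first exact: mx_cvg_cst.
  apply: mx_cvgN; apply: mx_cvgZ; first exact: cvg_cst.
  by apply: mx_cvgM; exact: mx_cvgZ.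
have WV : mx_cvg (fun n => invmx (W n)) 1%:M.
  by rewrite -[X in mx_cvg _ X]invmx1; apply: mx_cvg_inv => //; exact: unitmx1.
pose c n := 4 * al n / s n ^+ 2.
(* Hadamard for [invmx (W n)] and for [W n], raised to the power [al n]. *)
have lo : expR (- (c n * \tr (invmx (W n) *m (Y n *m Y n)))) @[n --> \oo] -->
    expR (- (\tr (B *m B)) / 2).
  have h : - (c n * \tr (invmx (W n) *m (Y n *m Y n))) @[n --> \oo] -->
      - (\tr (B *m B)) / 2.
    have -> : - (\tr (B *m B)) / 2 = - (2^-1 * \tr (1%:M *m (B *m B))).
      by rewrite mul1mx; field.
    apply: cvgN; apply: cvgM => //; apply: cvg_mxtrace.
    by apply: mx_cvgM => //; exact: mx_cvgM.
  by apply: (cvg_comp _ _ h); exact: continuous_expR.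
have hi : expR (- (c n * \tr (Y n *m Y n))) @[n --> \oo] -->
    expR (- (\tr (B *m B)) / 2).
  have h : - (c n * \tr (Y n *m Y n)) @[n --> \oo] --> - (\tr (B *m B)) / 2.
    have -> : - (\tr (B *m B)) / 2 = - (2^-1 * \tr (B *m B)) by field.
    by apply: cvgN; apply: cvgM => //; apply: cvg_mxtrace; exact: mx_cvgM.
  by apply: (cvg_comp _ _ h); exact: continuous_expR.
apply: (squeeze_cvgr _ lo hi).
apply: filterS rX => n rX.
have pW : posdef_S (W n) by rewrite WE; exact: beta_region_posdef.
have -> : cutdet (half + (s n)^-1 *: Y n) = \det (W n).
  by rewrite WE /cutdet; case: asboolP.
have d0 := posdef_S_det_gt0 pW; have uW := posdef_S_unit pW.
have sYY (A : 'M[R]_p) :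
    \tr (A *m (4 *: ((s n)^-1 *: Y n *m ((s n)^-1 *: Y n)))) =
    4 / s n ^+ 2 * \tr (A *m (Y n *m Y n)).
  rewrite -scalemxAl -!scalemxAr !mxtraceZ -!mulrA; congr (_ * _).
  by rewrite !mulrA expr2 invfM.
apply/andP; split.
  have -> : - (c n * \tr (invmx (W n) *m (Y n *m Y n))) =
      (p%:R - \tr (invmx (W n))) * al n.
    (* Writing [p] this way turns [p - tr W^-1] into [- tr (W^-1 (1 - W))], which exhibits the
       factor 4 / s^2. *)
    have -> : p%:R = \tr (invmx (W n) *m W n) by rewrite mulVmx// mxtrace1.
    rewrite {2}/W mulmxBr mulmx1 linearB/= sYY /c; ring.
  rewrite expRM; apply: (ge0_ler_powR (ltW (al0 n)) (expR_ge0 _) (ltW d0)).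
  exact: posdef_S_det_ge_exp.
have -> : - (c n * \tr (Y n *m Y n)) = (\tr (W n) - p%:R) * al n.
  have h := sYY 1%:M; rewrite !mul1mx in h.
  rewrite /W linearB/= mxtrace1 h /c; ring.
rewrite expRM; apply: (ge0_ler_powR (ltW (al0 n)) (ltW d0) (expR_ge0 _)).
exact: posdef_S_det_le_exp.
Qed.

Lemma symmetric_symmat_S (v : env) : symmetric_S (symmat_S v).
Proof.
apply/matrixP => i j; rewrite !mxE; case: ltngtP => // /val_inj ->.
by [].
Qed.

Lemma mx_cvg_symmat_S (u : nat -> env) v :
  env_cvg u v -> mx_cvg (fun n => symmat_S (u n)) (symmat_S v).
Proof.
move=> uv i j; rewrite mxE; under eq_fun do rewrite mxE.
by case: ifP => _; exact: uv.
Qed.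

Lemma uniq_ucoords_S : uniq (ucoords_S p).
Proof. by rewrite filter_uniq// enum_uniq. Qed.

Lemma mem_ucoords_S (k : coord_S p) : (k \in ucoords_S p) = (k.1 <= k.2)%N.
Proof. by rewrite mem_filter mem_enum finset.in_setT andbT. Qed.

(** Double counting: adding the count with both indices exchanged gives every pair once and the
    diagonal twice, hence [p + 1] per row. *)
Lemma size_ucoords_S : (size (ucoords_S p) * 2 = p * p.+1)%N.
Proof.
have -> : size (ucoords_S p) = (\sum_(k : coord_S p) (k.1 <= k.2)%N)%N.
  rewrite /ucoords_S size_filter -sum1_count big_mkcond/= big_enum/=.
  by apply: eq_big => [k|k _]; rewrite ?finset.in_setT//; case: ifP.
rewrite -(pair_bigA _ (fun i j : 'I_p => (i <= j)%N : nat))/=.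
rewrite muln2 -addnn {2}exchange_big -big_split/=.
transitivity (\sum_(i < p) (p + 1))%N; last first.
  by rewrite sum_nat_const card_ord addn1.
apply: eq_bigr => i _; rewrite -big_split/=.
rewrite (eq_bigr (fun j : 'I_p => 1 + (j == i))%N); last first.
  move=> j _; rewrite -val_eqE/=; by case: ltngtP.
rewrite big_split/= sum1_card card_ord (bigD1 i)//= eqxx big1 ?addn0//.
by move=> j /negPf ->.
Qed.

Lemma mxtrace_sqr_symmetric (Y : 'M[R]_p) : symmetric_S Y ->
  \tr (Y *m Y) = \sum_(k : coord_S p) Y k.1 k.2 ^+ 2.
Proof.
move=> sY; rewrite -(pair_bigA _ (fun i j => Y i j ^+ 2))/=.
apply: eq_bigr => i _; rewrite mxE; apply: eq_bigr => j _.
by rewrite -{2}sY mxE expr2.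
Qed.

Lemma mxtrace_sqr_ge0 (Y : 'M[R]_p) : symmetric_S Y -> 0 <= \tr (Y *m Y).
Proof.
by move=> sY; rewrite mxtrace_sqr_symmetric// sumr_ge0// => k _; exact: sqr_ge0.
Qed.

(** Off-diagonal coordinates occur twice in the trace; dropping one copy is enough for domination
    and treats all coordinates alike. *)
Lemma mxtrace_sqr_symmat_ge (v : env) :
  \sum_(k <- ucoords_S p) v k ^+ 2 <= \tr (symmat_S v *m symmat_S v).
Proof.
rewrite (mxtrace_sqr_symmetric (symmetric_symmat_S v)) /ucoords_S big_filter.
rewrite big_enum_cond/=.
rewrite [leRHS](bigID (fun k : coord_S p => (k.1 <= k.2)%N))/=.
rewrite [leLHS](_ : _ = \sum_(k : coord_S p | (k.1 <= k.2)%N)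
    symmat_S v k.1 k.2 ^+ 2); last first.
  apply: eq_big => [k|[i j] /= /andP[_ ij]]; first by rewrite finset.in_setT.
  by rewrite mxE ij.
by rewrite lerDl sumr_ge0// => k _; exact: sqr_ge0.
Qed.

(** Standard deviation 2 is chosen because [normal_fun 0 2 x] is exp(- x^2 / 8). *)
Lemma expR_mxtrace_le (v : env) :
  expR (- (\tr (symmat_S v *m symmat_S v) / 8)) <=
  \prod_(k <- ucoords_S p) normal_fun 0 2 (v k).
Proof.
rewrite /normal_fun -expR_sum ler_expR.
under eq_bigr do rewrite subr0.
rewrite -mulr_suml sumrN mulNr lerN2.
have -> : (2 : R) ^+ 2 *+ 2 = 8 by ring.
by rewrite ler_wpM2r// mxtrace_sqr_symmat_ge.
Qed.

End scaling_limit.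

(** * Convergence of the integrals *)

Section beta_limit.
Context {R : realType} {p : nat}.
Local Notation mu := (@lebesgue_measure R).
Local Notation half := ((2^-1 : R)%:M : 'M[R]_p).
Local Notation env := (coord_S p -> R).
Local Notation g := (normal_fun 0 2 : R -> R).
Local Notation us := (ucoords_S p).

Let g0 x : 0 <= g x. Proof. exact: normal_fun_ge0. Qed.

Let g1 x : g x <= 1.
Proof.
rewrite /normal_fun -[leRHS]expR0 ler_expR mulNr oppr_le0.
by rewrite mulr_ge0// ?sqr_ge0// invr_ge0 mulrn_wge0// sqr_ge0.
Qed.

Let ig : mu.-integrable setT (EFin \o g).
Proof. exact: integrable_normal_fun0. Qed.

Let env_sub_half (s : R) : env -> env :=
  env_affine s (fun k => if k.1 == k.2 then - (s / 2) else 0).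

Let symmat_sub_half s v :
  symmat_S (env_sub_half s v) = s *: (symmat_S v - half).
Proof.
apply/matrixP => i j; rewrite !mxE /env_sub_half /env_affine/=.
case: ltngtP => [ij|ij|/val_inj <-]; rewrite ?eqxx ?mulr1n; last by lra.
- have -> : (i == j) = false by apply/eqP => ijE; rewrite ijE ltnn in ij.
  by rewrite mulr0n subr0 addr0.
- have -> : (j == i) = false by apply/eqP => ijE; rewrite ijE ltnn in ij.
  have -> : (i == j) = false by apply/eqP => ijE; rewrite ijE ltnn in ij.
  by rewrite mulr0n subr0 addr0.
Qed.

Variables (a s : nat -> R) (M : R).
Let al n := a n - p.+1%:R / 2.
Hypotheses (al0 : forall n, 0 < al n) (s0 : forall n, 0 < s n).
Hypotheses (al4 : forall n, 4^-1 <= 4 * al n / s n ^+ 2).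
Hypotheses (a_y : a n @[n --> \oo] --> +oo).
Hypotheses (s_inv0 : (s n)^-1 @[n --> \oo] --> (0 : R)).
Hypotheses (a_s : 8 * a n / s n ^+ 2 @[n --> \oo] --> (1 : R)).

Let al_s : 4 * al n / s n ^+ 2 @[n --> \oo] --> (2^-1 : R).
Proof.
have -> : 2^-1 = 2^-1 * 1 - 2 * p.+1%:R * (0 * 0) :> R by ring.
apply: (@cvg_near_eqn _ (fun n => 2^-1 * (8 * a n / s n ^+ 2) -
  2 * p.+1%:R * ((s n)^-1 * (s n)^-1))).
  by apply: nearW => n; rewrite /al; field; rewrite gt_eqF.
by apply: cvgB; apply: cvgM => //; [exact: cvg_cst|exact: cvg_cst|exact: cvgM].
Qed.

Let normalizer n : R :=
  expR (- (2 * p%:R * al n * ln 2)) / mBeta_S p (a n) (a n).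

Let goe_cst : R :=
  (2 * pi) `^ (- (p%:R / 2)) * pi `^ (- ((p * (p - 1))%N%:R / 4)).

(** After cancellation of the terms in [a n * ln 2], the exponents add up to p(p + 1)/4 times ln a -
    2 ln s + 3 ln 2, that is [ln (8 * a n / s n ^+ 2)], which tends to 0. *)
Let cvg_normalizer :
  (s n)^-1 ^+ size us * normalizer n @[n --> \oo] --> goe_cst.
Proof.
pose L : R := pi `^ ((p * (p - 1))%N%:R / 4) * Num.sqrt (2 * pi) ^+ p.
have pi2 : 0 < 2 * pi :> R by rewrite mulr_gt0// pi_gt0.
have L0 : L != 0.
  by rewrite gt_eqF// mulr_gt0 ?powR_gt0 ?exprn_gt0 ?sqrtr_gt0 ?pi_gt0.
have -> : goe_cst = expR ((p * p.+1)%:R / 4 * ln 1) / L.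
  have sqE : Num.sqrt (2 * pi) ^+ p = (2 * pi) `^ (p%:R / 2) :> R.
    rewrite -(powR12_sqrt (ltW pi2)) -(powR_mulrn p (powR_ge0 _ _)).
    by rewrite -powRrM [X in _ `^ X = _]mulrC.
  by rewrite ln1 mulr0 expR0 mul1r /goe_cst !powRN /L sqE -invfM [in RHS]mulrC.
have h : expR ((p * p.+1)%:R / 4 * ln (8 * a n / s n ^+ 2)) @[n --> \oo] -->
    expR ((p * p.+1)%:R / 4 * ln (1 : R)).
  have h' : (p * p.+1)%:R / 4 * ln (8 * a n / s n ^+ 2) @[n --> \oo] -->
      (p * p.+1)%:R / 4 * ln (1 : R).
    apply: cvgM; first exact: cvg_cst.
    by apply: (cvg_comp _ _ a_s); exact: continuous_ln.
  by apply: (cvg_comp _ _ h'); exact: continuous_expR.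
have H := cvgM h (cvgV L0 (@mBeta_S_asymptotics _ p _ a_y)).
apply: (cvg_near_eqn _ (H _ _)).
near=> n.
have a0 : 0 < a n by near: n; move/cvgryPgt : a_y; apply.
have sN : (s n)^-1 ^+ size us = expR (- ((p * p.+1)%:R / 2 * ln (s n))).
  rewrite -size_ucoords_S natrM mulfK// expRN exprVn expRM_natl lnK//.
  by rewrite posrE.
rewrite /= sN /normalizer [(mBeta_S _ _ _ * _)^-1]invfM -expRN.
rewrite [(mBeta_S _ _ _)^-1 * _]mulrC !mulrA.
congr (_ / _); rewrite -!expRD; congr expR.
rewrite ln_div ?posrE ?exprn_gt0 ?mulr_gt0// lnXn// lnM ?posrE//.
have -> : ln 8 = 3 * ln 2 :> R.
  by rewrite (_ : 8 = 2 ^+ 3 :> R); [rewrite lnXn// mulr_natl|ring].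
by rewrite /al !natrM -!natr1; field.
Unshelve. all: by end_near. Qed.

Section test_functions.
(** The test function may depend on [n], as the second moment requires. Continuity at fixed [n]
    serves the measurability of partial integrals, while [h_cvg] serves the passage to the limit. *)
Variables (h_ : nat -> 'M[R]_p -> R) (h : 'M[R]_p -> R).
Hypotheses (M0 : 0 <= M).
Hypothesis h_cont : forall n (Y : nat -> 'M[R]_p) B,
  (forall k, symmetric_S (Y k)) -> symmetric_S B -> mx_cvg Y B ->
  h_ n (Y k) @[k --> \oo] --> h_ n B.
Hypothesis h_cvg : forall (Y : nat -> 'M[R]_p) B,
  (forall k, symmetric_S (Y k)) -> symmetric_S B -> mx_cvg Y B ->
  h_ k (Y k) @[k --> \oo] --> h B.
Hypothesis hcont : forall (Y : nat -> 'M[R]_p) B,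
  (forall k, symmetric_S (Y k)) -> symmetric_S B -> mx_cvg Y B ->
  h (Y k) @[k --> \oo] --> h B.
Hypothesis h_le : forall n Y, symmetric_S Y ->
  `|h_ n Y| <= M * expR (\tr (Y *m Y) / 8).
Hypothesis hle : forall Y, symmetric_S Y ->
  `|h Y| <= M * expR (\tr (Y *m Y) / 8).

Let f_ n (v : env) : R :=
  h_ n (symmat_S v) * cutdet (half + (s n)^-1 *: symmat_S v) `^ al n.

Let f (v : env) : R :=
  h (symmat_S v) * expR (- (\tr (symmat_S v *m symmat_S v)) / 2).

Let f_cont n : env_continuous (f_ n).
Proof.
move=> u v uv; have YB := mx_cvg_symmat_S uv.
apply: cvgM.
  by apply: h_cont => // [k|]; exact: symmetric_symmat_S.
apply: cvg_powR_ge0 => // [k|]; first exact: cutdet_ge0.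
apply: cvg_cutdet => [k||].
- by apply: symmetric_S_half_add; exact: symmetric_symmat_S.
- by apply: symmetric_S_half_add; exact: symmetric_symmat_S.
apply: mx_cvgD; first exact: mx_cvg_cst.
by apply: mx_cvgZ => //; exact: cvg_cst.
Qed.

Let fcont : env_continuous f.
Proof.
move=> u v uv; have YB := mx_cvg_symmat_S uv.
apply: cvgM.
  by apply: hcont => // [k|]; exact: symmetric_symmat_S.
have e : - (\tr (symmat_S (u n) *m symmat_S (u n))) / 2 @[n --> \oo] -->
    - (\tr (symmat_S v *m symmat_S v)) / 2.
  apply: cvgM; last exact: cvg_cst.
  by apply: cvgN; apply: cvg_mxtrace; exact: mx_cvgM.
by apply: (cvg_comp _ _ e); exact: continuous_expR.
Qed.

Let f_cvg (u : nat -> env) v : env_cvg u v -> f_ n (u n) @[n --> \oo] --> f v.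
Proof.
move=> uv; have YB := mx_cvg_symmat_S uv.
apply: cvgM.
  by apply: h_cvg => // [k|]; exact: symmetric_symmat_S.
by apply: cvg_cutdet_powR => // k; exact: symmetric_symmat_S.
Qed.

Let dom_le (v : env) (x y : R) :
  `|x| <= M * expR (\tr (symmat_S v *m symmat_S v) / 8) ->
  0 <= y <= expR (- (\tr (symmat_S v *m symmat_S v) / 4)) ->
  `|x * y| <= M * \prod_(k <- us) g (v k).
Proof.
set t := \tr _ => xM /andP[y0 yt].
apply: (@le_trans _ _ (M * expR (- (t / 8)))); last first.
  by rewrite ler_wpM2l// expR_mxtrace_le.
have -> : M * expR (- (t / 8)) = M * expR (t / 8) * expR (- (t / 4)).
  by rewrite -mulrA -expRD; congr (_ * expR _); field.
by rewrite normrM (ger0_norm y0) ler_pM.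
Qed.

Let f_dom n : dominated g M us (f_ n).
Proof.
move=> v; have sv := symmetric_symmat_S v.
apply: dom_le; first exact: h_le.
by rewrite powR_ge0 cutdet_powR_le// mxtrace_sqr_ge0.
Qed.

Let fdom : dominated g M us f.
Proof.
move=> v; have sv := symmetric_symmat_S v.
apply: dom_le; first exact: hle.
by rewrite expR_ge0 ler_expR; have := mxtrace_sqr_ge0 sv; lra.
Qed.

(** Change of variables Y = s(X - I/2); one factor [(s n)^-1] comes from each coordinate on or above
    the diagonal. *)
Let beta_integral n :
  intS_S p (fun X => (h_ n (s n *: (X - half)) *
    beta_pdf_S p (a n) (a n) X)%:E) =
  (((s n)^-1 ^+ size us * normalizer n)%:E *
    iint_S us (EFin \o f_ n) (fun=> 0%R))%E.
Proof.
have uus : uniq ([::] ++ us) by exact: uniq_ucoords_S.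
rewrite /intS_S.
have -> : (fun v : env => (h_ n (s n *: (symmat_S v - half)) *
      beta_pdf_S p (a n) (a n) (symmat_S v))%:E) =
    EFin \o ((fun w => normalizer n * f_ n w) \o env_sub_half (s n)).
  apply/funext => v /=; congr EFin; rewrite /f_ symmat_sub_half.
  rewrite beta_pdf_cutdet; last exact: al0.
  rewrite scalerA mulVf ?gt_eqF// scale1r [half + _]addrC subrK.
  by rewrite -/(al n) -/(normalizer n); ring.
have cf : env_continuous (fun w => normalizer n * f_ n w).
  by move=> u v uv; apply: cvgM; [exact: cvg_cst|exact: f_cont].
have df : dominated g (`|normalizer n| * M) ([::] ++ us)
    (fun w => normalizer n * f_ n w).
  by move=> v; rewrite normrM -mulrA ler_wpM2l// f_dom.
have C0 : 0 <= `|normalizer n| * M by rewrite mulr_ge0.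
rewrite /env_sub_half (iint_S_affine _ _ g0 g1 ig (s0 n) uus C0 cf df).
rewrite (@iint_S_scale R p g M [::] us _ (f_ n) _ g0 g1 ig uus M0
  (@f_cont n) (@f_dom n)).
rewrite EFinM muleA; congr (_ * _)%E.
(* The shift moves the base environment only on the diagonal, and those coordinates are all
   integrated. *)
apply: iint_S_eq_env => k; rewrite mem_ucoords_S /env_affine mulr0 add0r.
by case: eqP => [->|//]; rewrite leqnn.
Qed.

Lemma cvg_beta_integral :
  intS_S p (fun X => (h_ n (s n *: (X - half)) *
    beta_pdf_S p (a n) (a n) X)%:E) @[n --> \oo] -->
  intS_S p (fun Y => (h Y * goe_pdf_S p Y)%:E).
Proof.
have -> : intS_S p (fun Y => (h Y * goe_pdf_S p Y)%:E) =
    (goe_cst%:E * iint_S us (EFin \o f) (fun=> 0%R))%E.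
  rewrite -(@iint_S_scale R p g M [::] us goe_cst f (fun=> 0) g0 g1 ig
    (uniq_ucoords_S : uniq ([::] ++ us)) M0 fcont fdom).
  rewrite /intS_S; congr iint_S; apply/funext => v /=; congr EFin.
  by rewrite /f /goe_pdf_S -/goe_cst; ring.
have fin w c : env_continuous c -> dominated g M us c ->
    iint_S us (EFin \o c) w \is a fin_num.
  by move=> cc; apply: iint_S_fin (uniq_ucoords_S : uniq ([::] ++ us)) M0 cc.
under eq_fun do rewrite beta_integral.
apply: cvgeM => //.
- by rewrite mule_def_fin// fin.
- by apply: cvg_EFin; [exact: nearW|exact: cvg_normalizer].
- apply: (iint_S_dct g0 g1 ig uniq_ucoords_S M0) => //.
  exact: env_cvg_cst.
Qed.

End test_functions.
End beta_limit.

Lemma iint_S0 {R : realType} {p : nat} (s : seq (coord_S p))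
    (v : coord_S p -> R) : iint_S s (fun=> 0%E) v = 0%E.
Proof. by elim: s v => //= k s IH v; apply: integral0_eq => x _; exact: IH. Qed.

Lemma eq_intS_S {R : realType} {p : nat} (F G : 'M[R]_p -> \bar R) :
  (forall X, symmetric_S X -> F X = G X) -> intS_S p F = intS_S p G.
Proof.
move=> FG; rewrite /intS_S; congr iint_S; apply/funext => v.
by apply: FG; exact: symmetric_symmat_S.
Qed.

Unset Implicit Arguments.

Theorem theorem4p2 (R : realType) (p : nat) (hp : (0 < p)%N)
  (a : nat -> R) (gamma : R) (hgamma : 0 < gamma)
  (ha : forall n, (p%:R - 1) / 2 < a n)
  (hlim : (a n / n%:R) @[n --> \oo] --> gamma) :
  (* (i) L^2 convergence: E ||X_n - I/2||^2 -> 0 *)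
  (intS_S p (fun X : 'M[R]_p =>
       ((fnorm_S (X - (2^-1 : R)%:M)) ^+ 2 * beta_pdf_S p (a n) (a n) X)%:E)
     @[n --> \oo] --> 0%E)
  /\
  (* (ii) sqrt(8 gamma n) (X_n - I/2) converges in distribution to GOE *)
  (forall h : 'M[R]_p -> R,
     {within [set X | symmetric_S X], continuous h} ->
     (exists M : R, forall X, symmetric_S X -> `|h X| <= M) ->
     intS_S p (fun X : 'M[R]_p =>
         (h (Num.sqrt (8 * gamma * n%:R) *: (X - (2^-1 : R)%:M))
            * beta_pdf_S p (a n) (a n) X)%:E)
       @[n --> \oo] --> intS_S p (fun Y : 'M[R]_p => (h Y * goe_pdf_S p Y)%:E)).
Proof.
pose s n : R := Num.sqrt (8 * gamma * n%:R).
pose al n := a n - p.+1%:R / 2.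
have n_y : n%:R @[n --> \oo] --> (+oo : set_system R) by exact: cvgr_idn.
have ny A : \forall n \near \oo, A < n%:R :> R by move/cvgryPgt : n_y; apply.
have a_y : a n @[n --> \oo] --> +oo.
  apply/cvgryPge => A; near=> n.
  have n0 : 0 < n%:R :> R by near: n; exact: ny.
  have An : A / (gamma / 2) < n%:R by near: n; exact: ny.
  have : gamma / 2 < a n / n%:R.
    by near: n; apply: (cvgr_gt _ hlim); lra.
  rewrite ltr_pdivlMr// => /ltW; apply: le_trans.
  by move: An; rewrite ltr_pdivrMr ?divr_gt0// mulrC => /ltW.
have ninv : n%:R^-1 @[n --> \oo] --> (0 : R).
  by apply/gtr0_cvgV0 => //; exact: ny.
have s2 n : s n ^+ 2 = 8 * gamma * n%:R.
  by rewrite sqr_sqrtr// !mulr_ge0// ltW.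
have s_inv0 : (s n)^-1 @[n --> \oo] --> (0 : R).
  apply: cvg_sqrtV0; apply/cvgryPge => A.
  apply: filterS (ny (A / (8 * gamma))) => n.
  by rewrite ltr_pdivrMr ?mulr_gt0// mulrC => /ltW.
have a_s : 8 * a n / s n ^+ 2 @[n --> \oo] --> (1 : R).
  have -> : (1 : R) = gamma^-1 * gamma by rewrite mulVf// gt_eqF.
  apply: (@cvg_near_eqn _ (fun n => gamma^-1 * (a n / n%:R))).
    near=> n; have n0 : 0 < n%:R :> R by near: n; exact: ny.
    by rewrite s2; field; rewrite !gt_eqF.
  by apply: cvgM => //; exact: cvg_cst.
have al_s : 4 * al n / s n ^+ 2 @[n --> \oo] --> (2^-1 : R).
  have -> : 2^-1 = 2^-1 * 1 - p.+1%:R / (4 * gamma) * 0 :> R by ring.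
  apply: (@cvg_near_eqn _ (fun n => 2^-1 * (8 * a n / s n ^+ 2) -
      p.+1%:R / (4 * gamma) * n%:R^-1)).
    near=> n; have n0 : 0 < n%:R :> R by near: n; exact: ny.
    by rewrite s2 /al; field; rewrite !gt_eqF.
  by apply: cvgB; apply: cvgM => //; exact: cvg_cst.
(* The density is continuous at the boundary only once [al n > 0], and the uniform bounds hold only
   for large [n]. A finite prefix is dropped here, and [cvg_shiftn] restores it. *)
have [N _ HN] : \forall n \near \oo,
    [/\ 0 < al n, 1 <= s n & 4^-1 <= 4 * al n / s n ^+ 2].
  near=> n; split.
  - rewrite /al subr_gt0; near: n; move/cvgryPgt : a_y; exact.
  - rewrite /s -[leLHS]sqrtr1 ler_wsqrtr//.
    have : 1 / (8 * gamma) < n%:R by near: n; exact: ny.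
    by rewrite ltr_pdivrMr ?mulr_gt0// mulrC => /ltW.
  - by apply/ltW; near: n; apply: (cvgr_gt _ al_s); lra.
have Ns n : [/\ 0 < al (n + N)%N, 1 <= s (n + N)%N &
    4^-1 <= 4 * al (n + N)%N / s (n + N)%N ^+ 2].
  by apply: HN; rewrite /= leq_addl.
have sft (u : nat -> R) (l : R) :
    u n @[n --> \oo] --> l -> u (n + N)%N @[n --> \oo] --> l.
  by move=> ul; apply: (cvg_comp _ _ _ ul); exact: cvg_addnr.
have Nal n : 0 < al (n + N)%N by have [] := Ns n.
have Ns1 n : 1 <= s (n + N)%N by have [] := Ns n.
have Ns0 n : 0 < s (n + N)%N by exact: lt_le_trans (Ns1 n).
have Nal4 n : 4^-1 <= 4 * al (n + N)%N / s (n + N)%N ^+ 2 by have [] := Ns n.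
have Na_y : a (n + N)%N @[n --> \oo] --> +oo.
  by apply: (cvg_comp _ _ _ a_y); exact: cvg_addnr.
have Ns_inv : (s (n + N)%N)^-1 @[n --> \oo] --> (0 : R).
  exact: (sft (fun n => (s n)^-1)).
have Na_s := sft (fun n => 8 * a n / s n ^+ 2) _ a_s.
have limit := @cvg_beta_integral R p (fun n => a (n + N)%N)
  (fun n => s (n + N)%N) _ Nal Ns0 Nal4 Na_y Ns_inv Na_s.
split.
- rewrite -(cvg_shiftn N).
  (* At Y = s(X - I/2) this is the squared Frobenius norm of X - I/2; it tends to 0 along convergent
     matrices because of the factor s^-2. *)
  pose h_ n (Y : 'M[R]_p) :=
    \tr (Y *m Y) * ((s (n + N)%N)^-1 * (s (n + N)%N)^-1).
  have tr_cvg (Y : nat -> 'M[R]_p) B : mx_cvg Y B ->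
      \tr (Y n *m Y n) @[n --> \oo] --> \tr (B *m B).
    by move=> YB; apply: cvg_mxtrace; exact: mx_cvgM.
  have h_cvg0 (Y : nat -> 'M[R]_p) B : mx_cvg Y B ->
      h_ n (Y n) @[n --> \oo] --> (0 : R).
    move=> YB; have -> : 0 = \tr (B *m B) * (0 * 0) by ring.
    by apply: cvgM; [exact: tr_cvg|exact: cvgM].
  have h_le n (Y : 'M[R]_p) : symmetric_S Y ->
      `|h_ n Y| <= 8 * expR (\tr (Y *m Y) / 8).
    move=> sY; have t0 := mxtrace_sqr_ge0 sY.
    have si : 0 <= (s (n + N)%N)^-1 <= 1.
      by rewrite invr_ge0 (ltW (Ns0 n)) invf_le1 ?Ns1 ?Ns0.
    rewrite ger0_norm; last by rewrite !mulr_ge0//; lra.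
    (* The constant 8 comes from t <= 8 exp(t / 8) for the trace t; [1 <= s] allows the factor s^-2
       to be dropped. *)
    have e1 := expR_ge1Dx (\tr (Y *m Y) / 8).
    apply: (@le_trans _ _ (\tr (Y *m Y))); last by lra.
    by rewrite ler_piMr// mulr_ile1//; lra.
  have lim0 : intS_S p (fun X : 'M[R]_p =>
      (h_ n (s (n + N)%N *: (X - (2^-1 : R)%:M)) *
       beta_pdf_S p (a (n + N)%N) (a (n + N)%N) X)%:E) @[n --> \oo] -->
      intS_S p (fun Y : 'M[R]_p => (0 * goe_pdf_S p Y)%:E).
    apply: (limit 8 h_ (fun=> 0)) => //.
    - by move=> n Y B _ _ /tr_cvg YB; apply: cvgM => //; exact: cvg_cst.
    - by move=> Y B _ _; exact: h_cvg0.
    - by move=> Y B _ _ _; exact: cvg_cst.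
    - by move=> Y _; rewrite normr0 mulr_ge0// expR_ge0.
  have z0 : intS_S p (fun Y : 'M[R]_p => (0 * goe_pdf_S p Y)%:E) = 0%E.
    rewrite (@eq_intS_S _ _ _ (fun=> 0%E)); first exact: iint_S0.
    by move=> X _; rewrite mul0r.
  rewrite z0 in lim0; apply: (cvg_near_eqn _ lim0).
  apply: nearW => n; apply: eq_intS_S => X sX.
  have sZ : symmetric_S (X - (2^-1 : R)%:M).
    by rewrite /symmetric_S linearB/= tr_scalar_mx sX.
  rewrite /fnorm_S sqr_sqrtr ?mxtrace_sqr_ge0//; congr (_ * _)%:E.
  rewrite /h_ -scalemxAl -scalemxAr !mxtraceZ; field.
  by rewrite gt_eqF.
- move=> h hc [M hM]; rewrite -(cvg_shiftn N).
  have M0 : 0 <= M.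
    by apply: le_trans (hM 0 _); rewrite ?normr_ge0// /symmetric_S trmx0.
  have hcvg (Y : nat -> 'M[R]_p) B : (forall k, symmetric_S (Y k)) ->
      symmetric_S B -> mx_cvg Y B -> h (Y k) @[k --> \oo] --> h B.
    by move=> sY sB; exact: mx_cvg_within hc sY sB.
  have hle (Y : 'M[R]_p) : symmetric_S Y ->
      `|h Y| <= M * expR (\tr (Y *m Y) / 8).
    move=> sY; apply: (le_trans (hM _ sY)); rewrite ler_peMr//.
    by rewrite -[leLHS]expR0 ler_expR divr_ge0// mxtrace_sqr_ge0.
  exact: (limit M (fun=> h) h M0).
Unshelve. all: by end_near. Qed.
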